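(* Let $R$ be a skew-invertible Hecke symmetry and $\mathcal L(R_q,1)$ the associated modified reflection equation algebra (with $\hbar=1$). The maps $\Delta:\mathcal L(R_q,1)\to \mathbf L(R_q)$ and $\varepsilon:\mathcal L(R_q,1)\to\mathbb K$ defined by $$\Delta(e_{\mathcal L})=e_{\mathcal L}\otimes e_{\mathcal L},\qquad \Delta(l_i^j)=l_i^j\otimes e_{\mathcal L}+e_{\mathcal L}\otimes l_i^j-(q-q^{-1})\sum_k l_i^k\otimes l_k^j,\qquad \Delta(ab)=\Delta(a)\star\Delta(b),$$ $$\varepsilon(e_{\mathcal L})=1,\qquad\varepsilon(l_i^j)=0,\qquad\varepsilon(ab)=\varepsilon(a)\varepsilon(b)$$ for all $a,b\in\mathcal L(R_q,1)$, are respectively the coproduct and the counit of a braided bialgebra structure on $\mathcal L(R_q,1)$.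
   Context: $V$ is a finite dimensional space over $\mathbb K$, $N=\dim V$, basis $\{x_i\}$, summation convention. A Hecke symmetry is an invertible $R$ on $V^{\otimes2}$, $R(x_i\otimes x_j)=x_k\otimes x_lR^{kl}_{\;ij}$, with $R_{12}R_{23}R_{12}=R_{23}R_{12}R_{23}$ and $(R-qI)(R+q^{-1}I)=0$, $q\in\mathbb K^\times$ generic ($q=1$ or $q$ not a root of unity). It is skew-invertible if there is $\Psi$ with $R^{ia}_{\;jb}\Psi^{bl}_{\;ak}=\delta^i_k\delta^l_j=\Psi^{ia}_{\;jb}R^{bl}_{\;ak}$. Let $\bar R_{i_1i_2}^{\;\,j_1j_2}=R^{j_1j_2}_{\;\,i_1i_2}$ (lower indices number rows, upper ones columns), $L=\|l_i^j\|$ (row $i$, column $j$), $L_1=L\otimes I$. $\mathcal L(R_q,1)$ is the unital associative algebra (unit $e_{\mathcal L}$) generated by $l_i^j$, $1\le i,j\le N$, with relations $\bar R_{12}L_1\bar R_{12}L_1-L_1\bar R_{12}L_1\bar R_{12}=\bar R_{12}L_1-L_1\bar R_{12}$. The braiding $R_{\mathrm{End}}$: on the span of the $l_i^j$ it is given by $R_{\mathrm{End}}(L_{\bar1}\otimes L_{\bar2})=L_{\bar2}\otimes L_{\bar1}$, where $L_{\bar1}=L\otimes I$, $L_{\bar2}=\bar R_{12}L_{\bar1}\bar R_{12}^{-1}$ and matrix multiplication is understood (entrywise identities); it commutes trivially with the unit, $R_{\mathrm{End}}(e_{\mathcal L}\otimes a)=a\otimes e_{\mathcal L}$, $R_{\mathrm{End}}(a\otimes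 e_{\mathcal L})=e_{\mathcal L}\otimes a$, and is extended to products of generators in the usual way (a product is moved past an element factor by factor), giving a braiding on $\mathcal L(R_q,1)^{\otimes 2}$. $\mathbf L(R_q)$ is the vector space $\mathcal L(R_q,1)\otimes\mathcal L(R_q,1)$ with the associative product $(a_1\otimes b_1)\star(a_2\otimes b_2)=a_1a_2'\otimes b_1'b_2$, where $a_2'\otimes b_1':=R_{\mathrm{End}}(b_1\otimes a_2)$ (summation suppressed). A braided bialgebra structure means that $\Delta$ is a (well defined) algebra homomorphism into $\mathbf L(R_q)$, coassociative, that $\varepsilon$ is a (well defined) algebra homomorphism, and that $(\mathrm{id}\otimes\varepsilon)\Delta=\mathrm{id}=(\varepsilon\otimes\mathrm{id})\Delta$. *)

(* Defs.v *)
From HB Require Import structures.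
From mathcomp Require Import all_boot all_order all_algebra.
From mathcomp Require Import generic_quotient ring_quotient.
From mathcomp.classical Require Import boolp.
From mathcomp.finmap Require Import finmap.
From mathcomp.multinomials Require Import monalg.
From mathcomp.real_closed Require Import mxtens.

Set Implicit Arguments.
Unset Strict Implicit.
Unset Printing Implicit Defensive.

Import GRing.Theory.
Local Open Scope ring_scope.
Local Open Scope quotient_scope.

Inductive span (K : fieldType) (V : lmodType K) (S : V -> Prop) : V -> Prop :=
| span_gen x : S x -> span S x
| span_zero : span S 0
| span_add x y : span S x -> span S y -> span S (x + y)
| span_scale c x : span S x -> span S (c *: x).

Section LmodQuotient.
Variables (K : fieldType) (V : lmodType K) (S : V -> Prop).

Definition span_pred : {pred V} := fun x => `[< span S x >].

Lemma span_zmod_closed : zmod_closed span_pred.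
Proof.
split; first by apply/asboolP; exact: span_zero.
move=> x y /asboolP Sx /asboolP Sy; apply/asboolP.
by apply: span_add => //; rewrite -scaleN1r; exact: span_scale.
Qed.

HB.instance Definition _ :=
  GRing.isZmodClosed.Build V span_pred span_zmod_closed.

Definition lquot : Type := {ideal_quot span_pred}.

HB.instance Definition _ := GRing.Zmodule.on lquot.

Definition lproj (x : V) : lquot := \pi_({ideal_quot span_pred}) x.

Lemma lprojP (x y : V) : lproj x = lproj y <-> span S (x - y).
Proof.
split=> [e|/asboolP h].
  apply/asboolP; suff: x - y \in span_pred by [].
  by rewrite Quotient.idealrBE; apply/eqP.
by apply/eqP; rewrite /lproj -Quotient.idealrBE.
Qed.

Lemma lproj_reprK (u : lquot) : lproj (repr (u : {ideal_quot span_pred})) = u.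
Proof. exact: reprK. Qed.

Lemma lprojD : {morph lproj : x y / x + y}.
Proof. by move=> x y; rewrite /lproj; exact: raddfD. Qed.

Lemma lproj_surj (u : lquot) : exists x, lproj x = u.
Proof. by exists (repr (u : {ideal_quot span_pred})); rewrite lproj_reprK. Qed.

Definition lquot_scale (c : K) (u : lquot) : lquot :=
  lproj (c *: repr (u : {ideal_quot span_pred})).

Lemma lquot_scaleE c x : lquot_scale c (lproj x) = lproj (c *: x).
Proof.
apply/lprojP; rewrite -scalerBr; apply: span_scale.
by apply/lprojP; rewrite lproj_reprK.
Qed.

Fact lquot_scaleA a b u :
  lquot_scale a (lquot_scale b u) = lquot_scale (a * b) u.
Proof. by case: (lproj_surj u) => x <-; rewrite !lquot_scaleE scalerA. Qed.

Fact lquot_scale1 : left_id 1 lquot_scale.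
Proof. by move=> u; case: (lproj_surj u) => x <-; rewrite lquot_scaleE scale1r. Qed.

Fact lquot_scaleDr : right_distributive lquot_scale +%R.
Proof.
move=> c u v; case: (lproj_surj u) => x <-; case: (lproj_surj v) => y <-.
by rewrite -lprojD !lquot_scaleE scalerDr lprojD.
Qed.

Fact lquot_scaleDl u : {morph lquot_scale^~ u : a b / a + b}.
Proof.
move=> a b; case: (lproj_surj u) => x <-.
by rewrite !lquot_scaleE scalerDl lprojD.
Qed.

HB.instance Definition _ := GRing.Zmodule_isLmodule.Build K lquot
  lquot_scaleA lquot_scale1 lquot_scaleDr lquot_scaleDl.

Lemma lproj_linear : linear lproj.
Proof. by move=> c x y; rewrite lprojD -lquot_scaleE. Qed.

HB.instance Definition _ :=
  GRing.isLinear.Build K V lquot *:%R lproj lproj_linear.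

End LmodQuotient.

Section Tensor.
Variable K : fieldType.

Inductive tensor_rel (U V : lmodType K) : {malg K[(U * V)%type]} -> Prop :=
| tensor_rel_l (c : K) u u' v :
    tensor_rel (<< (c *: u + u', v) >> - (c *: << (u, v) >> + << (u', v) >>))
| tensor_rel_r (c : K) u v v' :
    tensor_rel (<< (u, c *: v + v') >> - (c *: << (u, v) >> + << (u, v') >>)).

Definition tensor (U V : lmodType K) : Type := lquot (@tensor_rel U V).

HB.instance Definition _ (U V : lmodType K) := GRing.Lmodule.on (tensor U V).

Definition tens (U V : lmodType K) (u : U) (v : V) : tensor U V :=
  lproj (@tensor_rel U V) << (u, v) >>.

Lemma tensE (U V : lmodType K) (u : U) (v : V) :
  tens u v = lproj (@tensor_rel U V) << (u, v) >>.
Proof. by []. Qed.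

Lemma tens_linearl (U V : lmodType K) (v : V) : linear (fun u : U => tens u v).
Proof.
move=> c u u'; rewrite !tensE -linearP; apply/lprojP.
by apply: span_gen; exact: tensor_rel_l.
Qed.

Lemma tens_linearr (U V : lmodType K) (u : U) : linear (fun v : V => tens u v).
Proof.
move=> c v v'; rewrite !tensE -linearP; apply/lprojP.
by apply: span_gen; exact: tensor_rel_r.
Qed.

Definition lin_ext (X : choiceType) (W : lmodType K) (f : X -> W)
    (g : {malg K[X]}) : W := \sum_(x <- msupp g) g@_x *: f x.

Lemma lin_extEw (X : choiceType) (W : lmodType K) (f : X -> W)
    (g : {malg K[X]}) (d : {fset X}) :
  fsubset (msupp g) d -> lin_ext f g = \sum_(x <- d) g@_x *: f x.
Proof.
move=> le; rewrite /lin_ext [LHS](big_fset_incl _ le) => //= x xd.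
by move=> /mcoeff_outdom ->; rewrite scale0r.
Qed.

Lemma lin_ext_linear (X : choiceType) (W : lmodType K) (f : X -> W) :
  linear (lin_ext f).
Proof.
move=> c g h; pose d := fsetU (fsetU (msupp g) (msupp h)) (msupp (c *: g + h)).
rewrite !(@lin_extEw _ _ _ _ d).
- rewrite scaler_sumr -big_split /=; apply: eq_bigr => x _.
  by rewrite mcoeffD mcoeffZ scalerDl scalerA.
- exact: fsubset_trans (fsubsetUr _ _) (fsubsetUl _ _).
- exact: fsubset_trans (fsubsetUl _ _) (fsubsetUl _ _).
- exact: fsubsetUr.
Qed.

Lemma lin_extU (X : choiceType) (W : lmodType K) (f : X -> W) (x : X) :
  lin_ext f << x >> = f x.
Proof.
rewrite (lin_extEw f msuppU_le) big_seq_fset1.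
by rewrite mcoeffUU scale1r.
Qed.

(* The linear map on the tensor product sending [u ⊗ v] to [f u v].  It is
   computed on a chosen representative, hence meaningful for bilinear [f] only:
   see [tensor_liftE] and [tensor_lift_linear]. *)
Definition tensor_lift (U V W : lmodType K) (f : U -> V -> W)
    (t : tensor U V) : W :=
  lin_ext (fun p => f p.1 p.2)
    (repr (t : {ideal_quot span_pred (@tensor_rel U V)})).

Section LiftTheory.
Variables (U V W : lmodType K) (f : U -> V -> W).
Hypotheses (fl : forall v, linear (f^~ v)) (fr : forall u, linear (f u)).

Let F := lin_ext (fun p : U * V => f p.1 p.2).

Lemma lin_ext_tensor_rel (g : {malg K[(U * V)%type]}) :
  span (@tensor_rel U V) g -> F g = 0.
Proof.
have FD c x y : F (c *: x + y) = c *: F x + F y by exact: lin_ext_linear.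
have FB x y : F (x - y) = F x - F y.
  by rewrite [x - y]addrC -[- y]scaleN1r FD scaleN1r addrC.
have F0 : F 0 = 0 by rewrite -(subrr (0 : {malg K[(U * V)%type]})) FB subrr.
elim=> {g} [g [c u u' v|c u v v']||x y _ Fx _ Fy|c x _ Fx].
- by rewrite FB FD /F !lin_extU /= fl subrr.
- by rewrite FB FD /F !lin_extU /= fr subrr.
- exact: F0.
- by rewrite -[x]scale1r FD Fx Fy scaler0 addr0.
- by rewrite -[c *: x]addr0 FD Fx F0 scaler0 addr0.
Qed.

Lemma tensor_lift_proj (g : {malg K[(U * V)%type]}) :
  tensor_lift f (lproj (@tensor_rel U V) g) = F g.
Proof.
rewrite /tensor_lift; set h := repr _; have : F (- 1 *: g + h) = 0.
  rewrite scaleN1r addrC; apply/lin_ext_tensor_rel/lprojP; exact: lproj_reprK.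
by rewrite /F lin_ext_linear scaleN1r addrC => /subr0_eq.
Qed.

Lemma tensor_lift_linear : linear (tensor_lift f).
Proof.
move=> c t t'; case: (lproj_surj t) => x <-; case: (lproj_surj t') => y <-.
by rewrite -linearP !tensor_lift_proj /F lin_ext_linear.
Qed.

Lemma tensor_liftE u v : tensor_lift f (tens u v) = f u v.
Proof. by rewrite tensE tensor_lift_proj /F lin_extU. Qed.

End LiftTheory.

Lemma tensor_ind (U V : lmodType K) (P : tensor U V -> Prop) :
  P 0 -> (forall c u v t, P t -> P (c *: tens u v + t)) -> forall t, P t.
Proof.
move=> P0 PD t; case: (lproj_surj t) => g <-.
rewrite [g](monalgE g); elim/big_rec: _ => [|[u v] h _ IH].
  by rewrite linear0.
rewrite linearD /=; have -> : << g@_(u, v) *g (u, v) >> =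
  g@_(u, v) *: << (u, v) >> :> {malg K[(U * V)%type]}.
  by apply/malgP=> k; rewrite mcoeffZ !mcoeffU mulr_natr.
by rewrite linearZ; exact: PD.
Qed.

Definition tensor_map (U V U' V' : lmodType K) (f : U -> U') (g : V -> V') :
    tensor U V -> tensor U' V' :=
  tensor_lift (fun u v => tens (f u) (g v)).

Definition tensor_assoc (U V W : lmodType K) :
    tensor (tensor U V) W -> tensor U (tensor V W) :=
  tensor_lift (fun t w => tensor_lift (fun u v => tens u (tens v w)) t).

End Tensor.

Notation "u ⊗ v" := (tens u v) (at level 40, left associativity) : ring_scope.

Section AlgQuotient.
Variables (K : fieldType) (A : algType K) (S : A -> Prop).

Inductive two_sided : A -> Prop :=
| two_sided_gen a x b : S x -> two_sided (a * x * b).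

Definition ideal : A -> Prop := span two_sided.

Lemma ideal_gen x : S x -> ideal x.
Proof. by move=> Sx; apply: span_gen; rewrite -[x]mulr1 -[x]mul1r. Qed.

Lemma ideal_mull a x : ideal x -> ideal (a * x).
Proof.
elim=> {x} [_ [b x c Sx]||x y _ Ix _ Iy|c x _ Ix].
- by apply: span_gen; rewrite !mulrA.
- by rewrite mulr0; exact: span_zero.
- by rewrite mulrDr; exact: span_add.
- by rewrite -scalerAr; exact: span_scale.
Qed.

Lemma ideal_mulr a x : ideal x -> ideal (x * a).
Proof.
elim=> {x} [_ [b x c Sx]||x y _ Ix _ Iy|c x _ Ix].
- by apply: span_gen; rewrite -mulrA.
- by rewrite mul0r; exact: span_zero.
- by rewrite mulrDl; exact: span_add.
- by rewrite -scalerAl; exact: span_scale.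
Qed.

(* The properness proof is a parameter because the algebra structures of the
   library are nontrivial rings. *)
Hypothesis proper : ~ ideal 1.

Definition aquot of ~ ideal 1 : Type := lquot two_sided.

Local Notation Q := (aquot proper).

HB.instance Definition _ := GRing.Lmodule.on Q.

Definition aproj (x : A) : Q := lproj two_sided x.

HB.instance Definition _ := GRing.Linear.copy aproj (lproj two_sided).

Lemma aprojP x y : aproj x = aproj y <-> ideal (x - y).
Proof. exact: lprojP. Qed.

Lemma aproj_surj (u : Q) : exists x, aproj x = u.
Proof. exact: lproj_surj. Qed.

Definition arepr (u : Q) : A := repr (u : {ideal_quot span_pred two_sided}).

Lemma areprK u : aproj (arepr u) = u.
Proof. exact: lproj_reprK. Qed.

Definition aquot_one : Q := aproj 1.
Definition aquot_mul (u v : Q) : Q := aproj (arepr u * arepr v).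

Lemma aquot_mulE x y : aquot_mul (aproj x) (aproj y) = aproj (x * y).
Proof.
have Ix : ideal (arepr (aproj x) - x) by apply/aprojP; rewrite areprK.
have Iy : ideal (arepr (aproj y) - y) by apply/aprojP; rewrite areprK.
apply/aprojP; set x' := arepr _ in Ix *; set y' := arepr _ in Iy *.
have -> : x' * y' - x * y = (x' - x) * y' + x * (y' - y).
  by rewrite mulrBl mulrBr addrA subrK.
by apply: span_add; [exact: ideal_mulr | exact: ideal_mull].
Qed.

Fact aquot_mulA : associative aquot_mul.
Proof.
move=> u v w; case: (aproj_surj u) => x <-; case: (aproj_surj v) => y <-.
by case: (aproj_surj w) => z <-; rewrite !aquot_mulE mulrA.
Qed.

Fact aquot_mul1l : left_id aquot_one aquot_mul.
Proof. by move=> u; case: (aproj_surj u) => x <-; rewrite aquot_mulE mul1r. Qed.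

Fact aquot_mul1r : right_id aquot_one aquot_mul.
Proof. by move=> u; case: (aproj_surj u) => x <-; rewrite aquot_mulE mulr1. Qed.

Fact aquot_mulDl : left_distributive aquot_mul +%R.
Proof.
move=> u v w; case: (aproj_surj u) => x <-; case: (aproj_surj v) => y <-.
case: (aproj_surj w) => z <-.
by rewrite -linearD !aquot_mulE mulrDl linearD.
Qed.

Fact aquot_mulDr : right_distributive aquot_mul +%R.
Proof.
move=> u v w; case: (aproj_surj u) => x <-; case: (aproj_surj v) => y <-.
case: (aproj_surj w) => z <-.
by rewrite -linearD !aquot_mulE mulrDr linearD.
Qed.

Fact aquot_one_neq0 : aquot_one != 0.
Proof.
apply/eqP; rewrite /aquot_one -(linear0 aproj) => /aprojP.
by rewrite subr0.
Qed.

HB.instance Definition _ := GRing.Zmodule_isNzRing.Build Q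
  aquot_mulA aquot_mul1l aquot_mul1r aquot_mulDl aquot_mulDr aquot_one_neq0.

Fact aquot_scaleAl c (u v : Q) : c *: (u * v) = (c *: u) * v.
Proof.
case: (aproj_surj u) => x <-; case: (aproj_surj v) => y <-.
have mE (a b : Q) : a * b = aquot_mul a b by [].
have ZE a b : a *: aproj b = aproj (a *: b) by rewrite linearZ.
by rewrite !mE ZE !aquot_mulE ZE scalerAl.
Qed.

HB.instance Definition _ := GRing.Lmodule_isLalgebra.Build K Q aquot_scaleAl.

Fact aquot_scaleAr c (u v : Q) : c *: (u * v) = u * (c *: v).
Proof.
case: (aproj_surj u) => x <-; case: (aproj_surj v) => y <-.
have mE (a b : Q) : a * b = aquot_mul a b by [].
have ZE a b : a *: aproj b = aproj (a *: b) by rewrite linearZ.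
by rewrite !mE ZE !aquot_mulE ZE scalerAr.
Qed.

HB.instance Definition _ := GRing.Lalgebra_isAlgebra.Build K Q aquot_scaleAr.

Fact aproj_monoid_morphism : monoid_morphism aproj.
Proof. by split=> // x y; rewrite -aquot_mulE. Qed.

HB.instance Definition _ :=
  GRing.isMonoidMorphism.Build A Q aproj aproj_monoid_morphism.

End AlgQuotient.

Section FreeAlgebra.
Variables (K : fieldType) (X : choiceType).

Definition free_alg : Type := {malg K[{fmonom X}]}.

HB.instance Definition _ := GRing.Lalgebra.on free_alg.

Fact free_alg_scaleAr (c : K) (x y : free_alg) : c *: (x * y) = x * (c *: y).
Proof.
have xC : x * malgC c = c *: x :> {malg K[{fmonom X}]}.
  rewrite malgM_def fgmulgU malgZ_def; apply: eq_bigr => k _.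
  by rewrite mulm1 mulrC.
rewrite -[c *: y](mul_malgC (K := {fmonom X}) c y).
by rewrite [RHS]mulrA -[(x * malgC c)%R]/(_ * _ : free_alg) xC scalerAl.
Qed.

HB.instance Definition _ :=
  GRing.Lalgebra_isAlgebra.Build K free_alg free_alg_scaleAr.

Definition free_gen (x : X) : free_alg := << fmu x >>.

End FreeAlgebra.

Arguments free_alg K%_type_scope X%_type_scope.

Section Matrices.
Variables (K : fieldType) (N : nat).

(* Indices of 'M_(N * N) are pairs via mxtens_index.  The operator R on V ⊗ V
   acts on columns of coordinates: row (k, l), column (i, j) holds R^{kl}_{ij}. *)
Implicit Type R : 'M[K]_(N * N).

Definition R12 R : 'M[K]_(N * (N * N)) :=
  castmx (esym (mulnA N N N), esym (mulnA N N N)) (R *t (1%:M : 'M_N)).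
Definition R23 R : 'M[K]_(N * (N * N)) := (1%:M : 'M_N) *t R.

Record hecke_symmetry (q : K) R : Prop := HeckeSymmetry {
  hecke_unit : R \in unitmx;
  hecke_braid : R12 R *m R23 R *m R12 R = R23 R *m R12 R *m R23 R;
  hecke_quad : (R - q%:M) *m (R + (q^-1)%:M) = 0;
  hecke_q_neq0 : q != 0;
  hecke_q_generic : q = 1 \/ forall n : nat, (0 < n)%N -> q ^+ n != 1
}.

Definition entry R (k l i j : 'I_N) : K :=
  R (mxtens_index (k, l)) (mxtens_index (i, j)).

Definition skew_invertible R : Prop :=
  exists Psi : 'M[K]_(N * N), forall i j k l : 'I_N,
    \sum_a \sum_b entry R i a j b * entry Psi b l a k
      = ((i == k) && (l == j))%:R
    /\ \sum_a \sum_b entry Psi i a j b * entry R b l a k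
      = ((i == k) && (l == j))%:R.

(* (Rbar)_{i1 i2}^{j1 j2} = R^{j1 j2}_{i1 i2}, lower indices numbering rows. *)
Definition Rbar R : 'M[K]_(N * N) := R^T.

Definition scal_mx (A : lalgType K) m n (M : 'M[K]_(m, n)) : 'M[A]_(m, n) :=
  map_mx (in_alg A) M.

Definition L_one (A : lalgType K) (L : 'M[A]_N) : 'M[A]_(N * N) :=
  L *t (1%:M : 'M_N).

Definition L_two (A : lalgType K) R (L : 'M[A]_N) : 'M[A]_(N * N) :=
  scal_mx A (Rbar R) *m L_one L *m scal_mx A (invmx (Rbar R)).

(* Difference of the two sides of the modified reflection equation, hbar = 1. *)
Definition mrea_defect (A : lalgType K) R (L : 'M[A]_N) : 'M[A]_(N * N) :=
  let Rb := scal_mx A (Rbar R) in let L1 := L_one L in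
  (Rb *m L1 *m Rb *m L1 - L1 *m Rb *m L1 *m Rb) - (Rb *m L1 - L1 *m Rb).

Lemma map_mrea_defect (A B : lalgType K) (f : {lrmorphism A -> B}) R
    (L : 'M[A]_N) :
  map_mx f (mrea_defect R L) = mrea_defect R (map_mx f L).
Proof.
have fS m n (M : 'M[K]_(m, n)) : map_mx f (scal_mx A M) = scal_mx B M.
  by apply/matrixP=> i j; rewrite !mxE /= linearZ rmorph1.
by rewrite /mrea_defect /= !(map_mxB, map_mxM, map_mxT, map_mx1, fS).
Qed.

Definition free_L : 'M[free_alg K ('I_N * 'I_N)%type]_N :=
  \matrix_(i, j) free_gen K (i, j).

Definition mrea_relators R (x : free_alg K ('I_N * 'I_N)%type) : Prop :=
  exists i j, x = mrea_defect R free_L i j.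
End Matrices.

Section Mrea.
Variables (K : fieldType) (N : nat) (R : 'M[K]_(N * N)).

Lemma mrea_proper : ~ ideal (mrea_relators R) 1.
Proof.
pose aug (x : free_alg K ('I_N * 'I_N)%type) : K^o :=
  mcoeff (mone : {fmonom ('I_N * 'I_N)%type}) x.
have augM : {morph aug : x y / x * y} by move=> x y; exact: rmorphM.
have augD : {morph aug : x y / x + y} by move=> x y; exact: raddfD.
have aug1 : aug 1 = 1 by exact: rmorph1.
have augZ c x : aug (c *: x) = c *: aug x by exact: mcoeffZ.
have auglin : linear aug by move=> c x y; rewrite augD augZ.
pose m1 := GRing.isLinear.Build K _ _ _ aug auglin.
pose m2 := GRing.isMonoidMorphism.Build _ _ aug (aug1, augM).
pose f : {lrmorphism _ -> K^o} := HB.pack aug m1 m2.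
have fL : map_mx f (free_L K N) = 0.
  apply/matrixP=> i j; rewrite !mxE /= /aug /free_gen mcoeffU.
  by rewrite fm1_eq1.
have f_rel x : mrea_relators R x -> f x = 0.
  case=> i [j ->]; transitivity (map_mx f (mrea_defect R (free_L K N)) i j).
    by rewrite [RHS]mxE.
  rewrite map_mrea_defect fL /mrea_defect /L_one tens0mx.
  by rewrite !(mulmx0, mul0mx, subr0) mxE.
have f_ideal x : ideal (mrea_relators R) x -> f x = 0.
  elim=> {x} [_ [a x b /f_rel fx]||x y _ fx _ fy|c x _ fx].
  - have fM : {morph f : u v / u * v} := augM.
    by rewrite !fM fx mulr0 mul0r.
  - by rewrite rmorph0.
  - have fD : {morph f : u v / u + v} := augD.
    by rewrite fD fx fy addr0.
  - have fZ : forall d u, f (d *: u) = d *: f u := augZ.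
    by rewrite fZ fx scaler0.
by move/f_ideal/eqP; rewrite rmorph1 oner_eq0.
Qed.

(* The modified reflection equation algebra L(R_q, 1). *)
Definition mrea : Type := aquot mrea_proper.

HB.instance Definition _ := GRing.Algebra.on mrea.

Definition mrea_L : 'M[mrea]_N := map_mx (aproj mrea_proper) (free_L K N).

Local Notation L := mrea_L.
Local Notation LL := (tensor mrea mrea).

(* Matrix product with the entries multiplied by ⊗ . *)
Definition tens_mulmx m n p (A : 'M[mrea]_(m, n)) (B : 'M[mrea]_(n, p)) :
    'M[LL]_(m, p) := \matrix_(i, j) \sum_k A i k ⊗ B k j.

(* L_one and L_two are the copies L_{\bar 1} and L_{\bar 2} of L. *)
Record is_R_End (sigma : LL -> LL) : Prop := IsREnd {
  R_End_linear : linear sigma;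
  R_End_gen : map_mx sigma (tens_mulmx (L_one L) (L_two R L))
              = tens_mulmx (L_two R L) (L_one L);
  R_End_1l : forall a : mrea, sigma (1 ⊗ a) = a ⊗ 1;
  R_End_1r : forall a : mrea, sigma (a ⊗ 1) = 1 ⊗ a;
  (* (ab) ⊗ c : first b, then a, is moved past c *)
  R_End_mull : forall a b c : mrea, sigma ((a * b) ⊗ c) =
    tensor_lift (fun c' b' : mrea => tensor_map id (fun x : mrea => x * b') (sigma (a ⊗ c')))
                (sigma (b ⊗ c));
  (* a ⊗ (bc) : a is moved past b, then past c *)
  R_End_mulr : forall a b c : mrea, sigma (a ⊗ (b * c)) =
    tensor_lift (fun b' a' : mrea => tensor_map (fun x : mrea => b' * x) id (sigma (a' ⊗ c)))
                (sigma (a ⊗ b))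
}.

Section Braided.
Variable sigma : LL -> LL.

(* (a1 ⊗ b1) ⋆ (a2 ⊗ b2) = a1 a2' ⊗ b1' b2, with a2' ⊗ b1' = sigma (b1 ⊗ a2),
   extended bilinearly. *)
Definition star (x y : LL) : LL :=
  tensor_lift (fun a1 b1 : mrea =>
    tensor_lift (fun a2 b2 : mrea =>
      tensor_map (fun x : mrea => a1 * x) (fun x : mrea => x * b2) (sigma (b1 ⊗ a2))) y) x.

Record is_Delta (q : K) (Delta : mrea -> LL) : Prop := IsDelta {
  Delta_linear : linear Delta;
  Delta_1 : Delta 1 = 1 ⊗ 1;
  Delta_gen : forall i j : 'I_N, Delta (L i j) =
    L i j ⊗ 1 + 1 ⊗ L i j - (q - q^-1) *: \sum_k L i k ⊗ L k j;
  Delta_mul : forall a b, Delta (a * b) = star (Delta a) (Delta b)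
}.

Record is_eps (eps : mrea -> K) : Prop := IsEps {
  eps_linear : scalar eps;
  eps_1 : eps 1 = 1;
  eps_gen : forall i j : 'I_N, eps (L i j) = 0;
  eps_mul : forall a b, eps (a * b) = eps a * eps b
}.

Record braided_bialgebra (Delta : mrea -> LL) (eps : mrea -> K) : Prop :=
  BraidedBialgebra {
  star_linearl : forall y, linear (fun x => star x y);
  star_linearr : forall x, linear (star x);
  star_assoc : associative star;
  star_1l : left_id (1 ⊗ 1) star;
  star_1r : right_id (1 ⊗ 1) star;
  coproduct_linear : linear Delta;
  coproduct_1 : Delta 1 = 1 ⊗ 1;
  coproduct_mul : forall a b, Delta (a * b) = star (Delta a) (Delta b);
  coproduct_coassoc : forall a,
    tensor_assoc (tensor_map Delta id (Delta a)) = tensor_map id Delta (Delta a);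
  counit_linear : scalar eps;
  counit_1 : eps 1 = 1;
  counit_mul : forall a b, eps (a * b) = eps a * eps b;
  (* K is identified with the scalars on either side of the tensor product *)
  counit_r : forall a, tensor_lift (fun x y : mrea => eps y *: x) (Delta a) = a;
  counit_l : forall a, tensor_lift (fun x y : mrea => eps x *: y) (Delta a) = a
}.

End Braided.
End Mrea.

Arguments mrea {K N} R.

(* Main.v *)
Require Import Defs.
From mathcomp Require Import all_boot all_order all_algebra ssrAC.
From HB Require Import structures.
From mathcomp Require Import generic_quotient ring_quotient.
From mathcomp.classical Require Import boolp.
From mathcomp.finmap Require Import finmap.
From mathcomp.multinomials Require Import monalg.
From mathcomp.real_closed Require Import mxtens.

(* Write X = L ⊗ 1, Y = 1 ⊗ L and X_2 = R X_1 R^-1 (R standing for Rbar).  The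
   braiding is equivalent to the cross relation Y_1 X_2 = X_2 Y_1, which skew
   invertibility solves for the products of an entry of Y by an entry of X.
   For every module M over A = L(R_q, 1), operators m_ij on M extend uniquely to
   operators on A ⊗ M that are 1 ⊗ m on 1 ⊗ M and satisfy the cross relation with
   left multiplication X; the extension respects matrix products, the reflection
   equation and cross relations.  This makes Y a representation of A on A ⊗ A,
   which defines the braiding and shows that A ⊗ A acts on itself by the product ⋆.
   By the Hecke relation, Z = X + Y - (q - q^-1) X Y again satisfies the reflection
   equation (1 - (q - q^-1) Z is the product of the corresponding matrices for X
   and Y), so A acts through Z on A ⊗ A and Delta a is the image of 1 ⊗ 1 under a.
   Coassociativity and the counit laws follow because both sides intertwine Z with
   the same operators, by uniqueness of the extensions. *)

Set Implicit Arguments.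
Unset Strict Implicit.
Unset Printing Implicit Defensive.

Import GRing.Theory.
Local Open Scope ring_scope.

(** * Linear endomorphisms of a nonzero space *)

(** The tensor square is not an algebra before the braiding exists, so relations are checked in
    algebras of endomorphisms of [A ⊗ M], where nothing has to be known beforehand. The obstacle is
    that the cross relation equates sums of products with R-matrices standing between the factors:
    the vanishing of one operator cannot be carried past one generator. It is carried past for a
    whole matrix [E] of operators at once. If [E_12], placed on factors 1 and 2 of [V ⊗ V ⊗ V],
    commutes with the copy [X_3] of [X] on factor 3, then the products [E X] are recovered from the
    products [X E] by undoing two contractions with [R], each invertible by skew invertibility. The
    module [M] stays arbitrary because two instances are needed: [M = A] for the braided square and
    [M = A ⊗ A] for the cube in which coassociativity is stated. The constant [z = q - q^-1] is the
    coefficient in the Hecke relation [Rb Rb = 1 + z Rb]. When it vanishes, [1 - z Z] says nothing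
    about [Z], and the reflection equation for [X + Y] is verified directly. *)

Section EndoDef.
Variables (K : fieldType) (W : lmodType K) (w0 : W).

(* The nonzero vector is a parameter because the algebras of the library are
   nontrivial rings. *)
Record endo (w0_neq0 : w0 != 0) := Endo { endo_fun :> W -> W; _ : linear endo_fun }.

Hypothesis w0_neq0 : w0 != 0.
Local Notation E := (endo w0_neq0).

Lemma endo_linear (f : E) : linear f. Proof. by case: f. Qed.

HB.instance Definition _ (f : E) :=
  GRing.isLinear.Build K W W *:%R f (endo_linear f).

Lemma endoP (f g : E) : f =1 g -> f = g.
Proof.
case: f g => f lf [g lg] /= /funext e; case: _ / e in lg *.
by congr Endo; exact: Prop_irrelevance.
Qed.

HB.instance Definition _ := gen_eqMixin E.
HB.instance Definition _ := gen_choiceMixin E.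

Fact endo_zero_subproof : linear (fun _ : W => 0 : W).
Proof. by move=> c u v; rewrite scaler0 addr0. Qed.
Fact endo_opp_subproof (f : E) : linear (fun w => - f w).
Proof. by move=> c u v; rewrite linearP opprD scalerN. Qed.
Fact endo_add_subproof (f g : E) : linear (fun w => f w + g w).
Proof. by move=> c u v; rewrite !linearP scalerDr addrACA. Qed.
Fact endo_mul_subproof (f g : E) : linear (fun w => f (g w)).
Proof. by move=> c u v; rewrite !linearP. Qed.
Fact endo_one_subproof : linear (fun w : W => w).
Proof. by []. Qed.
Fact endo_scale_subproof (a : K) (f : E) : linear (fun w => a *: f w).
Proof. by move=> c u v; rewrite !linearP. Qed.

Definition endo_zero : E := Endo _ endo_zero_subproof.
Definition endo_opp f : E := Endo _ (endo_opp_subproof f).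
Definition endo_add f g : E := Endo _ (endo_add_subproof f g).
Definition endo_mul f g : E := Endo _ (endo_mul_subproof f g).
Definition endo_one : E := Endo _ endo_one_subproof.
Definition endo_scale a f : E := Endo _ (endo_scale_subproof a f).

Fact endo_addA : associative endo_add.
Proof. by move=> f g h; apply: endoP => w; exact: addrA. Qed.
Fact endo_addC : commutative endo_add.
Proof. by move=> f g; apply: endoP => w; exact: addrC. Qed.
Fact endo_add0 : left_id endo_zero endo_add.
Proof. by move=> f; apply: endoP => w; exact: add0r. Qed.
Fact endo_addN : left_inverse endo_zero endo_opp endo_add.
Proof. by move=> f; apply: endoP => w; exact: addNr. Qed.

HB.instance Definition _ :=
  GRing.isZmodule.Build E endo_addA endo_addC endo_add0 endo_addN.

Fact endo_mulA : associative endo_mul.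
Proof. by move=> f g h; apply: endoP. Qed.
Fact endo_mul1 : left_id endo_one endo_mul.
Proof. by move=> f; apply: endoP. Qed.
Fact endo_mulr1 : right_id endo_one endo_mul.
Proof. by move=> f; apply: endoP. Qed.
Fact endo_mulDl : left_distributive endo_mul +%R.
Proof. by move=> f g h; apply: endoP. Qed.
Fact endo_mulDr : right_distributive endo_mul +%R.
Proof. by move=> f g h; apply: endoP => w; exact: linearD. Qed.
Fact endo_one_neq0 : endo_one != 0.
Proof. by apply/eqP => /(congr1 (fun f : E => f w0)) /eqP; exact/negP. Qed.

HB.instance Definition _ := GRing.Zmodule_isNzRing.Build E
  endo_mulA endo_mul1 endo_mulr1 endo_mulDl endo_mulDr endo_one_neq0.

Fact endo_scaleA a b f : endo_scale a (endo_scale b f) = endo_scale (a * b) f.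
Proof. by apply: endoP => w; exact: scalerA. Qed.
Fact endo_scale1 : left_id 1 endo_scale.
Proof. by move=> f; apply: endoP => w; exact: scale1r. Qed.
Fact endo_scaleDr : right_distributive endo_scale +%R.
Proof. by move=> a f g; apply: endoP => w; exact: scalerDr. Qed.
Fact endo_scaleDl f : {morph endo_scale^~ f : a b / a + b}.
Proof. by move=> a b; apply: endoP => w; exact: scalerDl. Qed.

HB.instance Definition _ := GRing.Zmodule_isLmodule.Build K E
  endo_scaleA endo_scale1 endo_scaleDr endo_scaleDl.

Fact endo_scaleAl a (f g : E) : a *: (f * g) = (a *: f) * g.
Proof. exact: endoP. Qed.

HB.instance Definition _ := GRing.Lmodule_isLalgebra.Build K E endo_scaleAl.

Fact endo_scaleAr a (f g : E) : a *: (f * g) = f * (a *: g).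
Proof. by apply: endoP => w /=; rewrite -[RHS]/(f (a *: g w)) linearZ. Qed.

HB.instance Definition _ := GRing.Lalgebra_isAlgebra.Build K E endo_scaleAr.

Lemma endo0E w : (0 : E) w = 0. Proof. by []. Qed.
Lemma endo1E w : (1 : E) w = w. Proof. by []. Qed.
Lemma endoDE (f g : E) w : (f + g) w = f w + g w. Proof. by []. Qed.
Lemma endoNE (f : E) w : (- f) w = - f w. Proof. by []. Qed.
Lemma endoME (f g : E) w : (f * g) w = f (g w). Proof. by []. Qed.
Lemma endoZE a (f : E) w : (a *: f) w = a *: f w. Proof. by []. Qed.
Lemma endo_sumE (I : Type) (r : seq I) (P : pred I) (F : I -> E) w :
  (\sum_(i <- r | P i) F i) w = \sum_(i <- r | P i) F i w.
Proof. exact: (big_morph (fun f : E => f w)). Qed.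

Definition endoE := (endo0E, endo1E, endoDE, endoNE, endoME, endoZE, endo_sumE).

Definition endo_eval w (f : E) : W := f w.

HB.instance Definition _ w :=
  GRing.isLinear.Build K E W *:%R (endo_eval w) (fun _ _ _ => erefl).

End EndoDef.

(** * Universal property of the modified reflection equation algebra *)

Section FreeUniversal.
Variables (K : fieldType) (X : choiceType).

Lemma malgUZ (Y : choiceType) (c : K) (y : Y) :
  << c *g y >> = c *: << y >> :> {malg K[Y]}.
Proof. by apply/malgP=> k; rewrite mcoeffZ !mcoeffU mulr_natr. Qed.

Lemma malgUM (M : monomType) (u v : M) :
  << u >> * << v >> = << mmul u v >> :> {malg K[M]}.
Proof. by rewrite malgM_def fgmulUU mulr1. Qed.

Lemma malg_ind (Y : choiceType) (P : {malg K[Y]} -> Prop) :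
    P 0 -> (forall c y z, P z -> P (c *: << y >> + z)) -> forall x, P x.
Proof.
move=> P0 PD x; rewrite [x](monalgE x); elim/big_rec: _ => // w y _ Py.
by rewrite malgUZ; exact: PD.
Qed.

Lemma free_alg_ind (P : free_alg K X -> Prop) :
    P 1 -> (forall c x y, P x -> P y -> P (c *: x + y)) ->
    (forall i x, P x -> P (free_gen K i * x)) ->
  forall x, P x.
Proof.
move=> P1 PD PM; apply: malg_ind => [|c [w] x Px].
  by rewrite -(addNr 1) -scaleN1r; exact: PD.
apply: PD => // {x Px c}; elim: w => [|i w Pw].
  by rewrite -[X in << X >>]/(FMonom [::]) -fmoneE.
suff -> : << FMonom (i :: w) >> = free_gen K i * << FMonom w >> by exact: PM.
rewrite /free_gen [RHS]malgUM -[mmul _ _]/(fmmul (fmu i) (FMonom w)).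
by rewrite fmuE fmmulE.
Qed.

Lemma free_alg_lift (B : algType K) (g : X -> B) :
  exists f : {lrmorphism free_alg K X -> B}, forall i, f (free_gen K i) = g i.
Proof.
have [h [h1 hM hg]] : exists h : {fmonom X} -> B, [/\ h mone = 1,
    {morph h : x y / mmul x y >-> x * y} & forall i, h (fmu i) = g i].
  exists (fun w => \prod_(i <- w) g i); split=> [|x y|i].
  - by rewrite fm1 big_nil.
  - by rewrite fmM big_cat.
  - by rewrite fmU big_seq1.
(* Monomials and the linear extension are hidden behind an existential: only their multiplication
   rule and the fact that monomials span are used afterwards. *)
have [mon [F [mon1 monM mong mon_ind [Fl FU]]]] :
    exists (mon : {fmonom X} -> free_alg K X) (F : free_alg K X -> B),
    [/\ mon mone = 1, forall u v, mon u * mon v = mon (mmul u v),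
    forall i, mon (fmu i) = free_gen K i,
    forall P : free_alg K X -> Prop, P 0 ->
      (forall c u x, P x -> P (c *: mon u + x)) -> forall x, P x
    & linear F /\ forall u, F (mon u) = h u].
  exists (fun u => << u >>), (lin_ext h); split=> // [u v|P|].
  - exact: malgUM.
  - exact: malg_ind.
  - by split=> [|u]; [exact: lin_ext_linear|exact: lin_extU].
have F0 : F 0 = 0 by rewrite -(addNr 0) -scaleN1r Fl scaleN1r addNr.
have FM : monoid_morphism F.
  split=> [|x y]; first by rewrite -h1 -FU mon1.
  have F_mull u z : F (mon u * z) = h u * F z.
    elim/mon_ind: z => [|d v z IHz]; first by rewrite mulr0 F0 mulr0.
    by rewrite mulrDr -scalerAr monM !Fl !FU hM IHz mulrDr scalerAr.
  elim/mon_ind: x => [|c u x IHx]; first by rewrite mul0r F0 mul0r.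
  by rewrite [in RHS]Fl FU [RHS]mulrDl -[in RHS]scalerAl -IHx -F_mull -Fl mulrDl scalerAl.
pose m1 := GRing.isLinear.Build K _ _ _ F Fl.
pose m2 := GRing.isMonoidMorphism.Build _ _ F FM.
pose f : {lrmorphism free_alg K X -> B} := HB.pack F m1 m2.
exists f => i.
by rewrite -[LHS]/(F (free_gen K i)) -mong FU hg.
Qed.

End FreeUniversal.

Section MreaUniversal.
Variables (K : fieldType) (N : nat) (R : 'M[K]_(N * N)).
Local Notation A := (mrea R).
Local Notation L := (mrea_L R).
Local Notation pi := (aproj (@mrea_proper K N R)).

Lemma pi_surj (a : A) : exists x, pi x = a.
Proof. exact: aproj_surj. Qed.

Lemma mrea_ind (P : A -> Prop) :
    P 1 -> (forall c x y, P x -> P y -> P (c *: x + y)) ->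
    (forall i j x, P x -> P (L i j * x)) ->
  forall x, P x.
Proof.
move=> P1 PD PM a; have [x <-] := pi_surj a.
elim/free_alg_ind: x => [|c x y Px Py|[i j] x Px].
- by rewrite rmorph1.
- by rewrite linearP; exact: PD.
- by rewrite rmorphM /=; have := PM i j _ Px; rewrite !mxE.
Qed.

Lemma mrea_defect_L : mrea_defect R L = 0.
Proof.
rewrite /mrea_L -(map_mrea_defect pi).
apply/matrixP=> i j; rewrite [LHS]mxE [RHS]mxE -[RHS](linear0 pi).
by apply/aprojP; rewrite subr0; apply: ideal_gen; exists i, j.
Qed.

(** The well-definedness of the counit, of the action behind the braiding and of the coproduct all
    reduce to this: one matrix identity in the target replaces a check on the ideal. *)
Lemma mrea_lift (B : algType K) (M : 'M[B]_N) : mrea_defect R M = 0 ->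
  exists f : {lrmorphism A -> B}, forall i j, f (L i j) = M i j.
Proof.
move=> M0; have [g gE] := free_alg_lift (fun p : 'I_N * 'I_N => M p.1 p.2).
have gL : map_mx g (free_L K N) = M by apply/matrixP=> i j; rewrite !mxE gE.
have gD i j : g (mrea_defect R (free_L K N) i j) = 0.
  transitivity (map_mx g (mrea_defect R (free_L K N)) i j).
    by rewrite [RHS]mxE.
  by rewrite map_mrea_defect gL M0 mxE.
have g0 x : ideal (mrea_relators R) x -> g x = 0.
  elim=> {x} [_ [a x b [i [j ->]]]||x y _ gx _ gy|c x _ gx].
  - move: (gD i j); move: (mrea_defect _ _ i j) => d gd.
    by rewrite !rmorphM /= gd mulr0 mul0r.
  - exact: linear0.
  - by rewrite linearD /= gx gy addr0.
  - by rewrite linearZ /= gx scaler0.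
pose f (a : A) : B := g (@arepr _ _ _ (@mrea_proper K N R) a).
have fE x : f (pi x) = g x.
  apply/eqP; rewrite -subr_eq0 -linearB; apply/eqP/g0/(aprojP (@mrea_proper K N R)).
  exact: (@areprK _ _ _ (@mrea_proper K N R)).
have fl : linear f.
  move=> c u v; have [x <-] := pi_surj u; have [y <-] := pi_surj v.
  by rewrite -linearP !fE linearP.
have fM : monoid_morphism f.
  split=> [|u v]; first by rewrite -[1](rmorph1 pi) fE rmorph1.
  have [x <-] := pi_surj u; have [y <-] := pi_surj v.
  by rewrite -rmorphM !fE rmorphM.
pose m1 := GRing.isLinear.Build K _ _ _ f fl.
pose m2 := GRing.isMonoidMorphism.Build _ _ f fM.
pose h : {lrmorphism A -> B} := HB.pack f m1 m2.
exists h => i j.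
by rewrite -[LHS]/(f (mrea_L R i j)) mxE fE -[in RHS]gL [RHS]mxE.
Qed.

End MreaUniversal.

(* All that the proof uses about the modified reflection equation algebra. *)
Record presented (K : fieldType) (N : nat) (R : 'M[K]_(N * N)) (A : algType K)
    (L : 'M[A]_N) : Prop := Presented {
  presented_ind : forall P : A -> Prop, P 1 ->
    (forall c x y, P x -> P y -> P (c *: x + y)) ->
    (forall i j x, P x -> P (L i j * x)) -> forall x, P x;
  presented_defect : mrea_defect R L = 0;
  presented_lift : forall (B : algType K) (M : 'M[B]_N), mrea_defect R M = 0 ->
    exists f : {lrmorphism A -> B}, forall i j, f (L i j) = M i j
}.

Lemma mrea_presented (K : fieldType) (N : nat) (R : 'M[K]_(N * N)) :
  presented R (mrea_L R).
Proof.
split; [exact: mrea_ind|exact: mrea_defect_L|exact: mrea_lift].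
Qed.

Lemma linear_for0 (K : fieldType) (U V : lmodType K) (f : U -> V) :
  linear f -> f 0 = 0.
Proof. by move=> fl; rewrite -(addNr 0) -scaleN1r fl scaleN1r addNr. Qed.

Lemma tensor_mor_ext (K : fieldType) (U V W : lmodType K)
    (f g : tensor U V -> W) : linear f -> linear g ->
  (forall u v, f (u ⊗ v) = g (u ⊗ v)) -> f =1 g.
Proof.
move=> fl gl e; elim/tensor_ind => [|c u v t IH].
  by rewrite !linear_for0.
by rewrite fl gl e IH.
Qed.

Notation "⟨ i , j ⟩" := (mxtens_index (i, j)) (format "⟨ i ,  j ⟩").

(** * Cross relations *)

Section TensorIndices.
Variable K : fieldType.
Implicit Types B : algType K.

Lemma sum_mxtens (V : nmodType) m n (F : 'I_(m * n) -> V) :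
  \sum_k F k = \sum_i \sum_j F ⟨i, j⟩.
Proof.
rewrite pair_bigA /=; have tensK : {on xpredT, bijective (@mxtens_index m n)}.
  exists (@mxtens_unindex m n) => k _; first exact: mxtens_indexK.
  exact: mxtens_unindexK.
transitivity (\sum_p F (@mxtens_index m n p)).
  exact: reindex.
by apply: eq_bigr => -[i j] _.
Qed.

Lemma matrix_tensP (T : Type) m n p s (M M' : 'M[T]_(m * n, p * s)) :
  (forall i i' j j', M ⟨i, i'⟩ ⟨j, j'⟩ = M' ⟨i, i'⟩ ⟨j, j'⟩) -> M = M'.
Proof.
move=> e; apply/matrixP=> i j.
by case: (mxtens_indexP i) => i1 i2; case: (mxtens_indexP j) => j1 j2.
Qed.

Lemma mul_tensmx1 B m n p s (M : 'M[B]_(m, n)) (M' : 'M[B]_(n * p, s)) i i' k :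
  ((M *t (1%:M : 'M_p)) *m M') ⟨i, i'⟩ k = \sum_a M i a * M' ⟨a, i'⟩ k.
Proof.
rewrite mxE sum_mxtens; apply: eq_bigr => a _.
rewrite (bigD1 i') //= big1 => [|j ji]; rewrite tensmxE mxE ?eqxx.
  by rewrite mulr1 addr0.
by rewrite eq_sym (negPf ji) mulr0 mul0r.
Qed.

Lemma mul_mx_tensmx1 B m n p s (M : 'M[B]_(m, n)) (M' : 'M[B]_(s, m * p)) k j j' :
  (M' *m (M *t (1%:M : 'M_p))) k ⟨j, j'⟩ = \sum_b M' k ⟨b, j'⟩ * M b j.
Proof.
rewrite mxE sum_mxtens; apply: eq_bigr => b _.
rewrite (bigD1 j') //= big1 => [|i ij]; rewrite tensmxE mxE ?eqxx.
  by rewrite mulr1 addr0.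
by rewrite (negPf ij) !mulr0.
Qed.

Lemma scal_mxM B m n p (P : 'M[K]_(m, n)) (Q : 'M[K]_(n, p)) :
  scal_mx B (P *m Q) = scal_mx B P *m scal_mx B Q.
Proof. exact: map_mxM. Qed.

Lemma scal_mx1 B n : scal_mx B (1%:M : 'M_n) = 1%:M.
Proof. exact: map_mx1. Qed.

Lemma mul_scal_mx B m n p (P : 'M[K]_(m, n)) (M : 'M[B]_(n, p)) i j :
  (scal_mx B P *m M) i j = \sum_k P i k *: M k j.
Proof.
by rewrite mxE; apply: eq_bigr => k _; rewrite mxE /= -scalerAl mul1r.
Qed.

Lemma mul_mx_scal B m n p (M : 'M[B]_(m, n)) (P : 'M[K]_(n, p)) i j :
  (M *m scal_mx B P) i j = \sum_k P k j *: M i k.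
Proof.
by rewrite mxE; apply: eq_bigr => k _; rewrite mxE /= -scalerAr mulr1.
Qed.

End TensorIndices.

Section Cross.
Variables (K : fieldType) (N : nat) (R : 'M[K]_(N * N)).
Local Notation Rb := (Rbar R).
Local Notation Ri := (invmx (Rbar R)).
Hypothesis R_unit : R \in unitmx.

Lemma Rbar_unit : Rb \in unitmx.
Proof. by rewrite unitmx_tr. Qed.

(* [Y_1 X_2 = X_2 Y_1], where [X_2 = Rb X_1 Rb^-1]. *)
Definition cross (B : algType K) (X Y : 'M[B]_N) : Prop :=
  comm_mx (L_one Y) (L_two R X).

Variable Psi : 'M[K]_(N * N).
Hypothesis R_Psi : forall i j k l : 'I_N,
  \sum_a \sum_b entry R i a j b * entry Psi b l a k = ((i == k) && (l == j))%:R.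
Hypothesis Psi_R : forall i j k l : 'I_N,
  \sum_a \sum_b entry Psi i a j b * entry R b l a k = ((i == k) && (l == j))%:R.

(** [R] read as a linear map from families indexed by [(a, b)] to families indexed by [(i, j)], one
    lower and one upper index on each side. Skew invertibility says exactly that this map is
    bijective, with inverse [unskewing]. *)
Definition skewing (W : lmodType K) (p : 'I_N -> 'I_N -> W) (i j : 'I_N) : W :=
  \sum_a \sum_b Rb ⟨a, i⟩ ⟨b, j⟩ *: p a b.

Definition unskewing (W : lmodType K) (p : 'I_N -> 'I_N -> W) (a b : 'I_N) : W :=
  \sum_i \sum_j entry Psi i a j b *: p i j.

Lemma sum_delta2 (W : lmodType K) (p : 'I_N -> 'I_N -> W) a b :
  \sum_i \sum_j ((i == a) && (j == b))%:R *: p i j = p a b.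
Proof.
rewrite (bigD1 a) //= (bigD1 b) //= !eqxx scale1r.
rewrite big1 => [|j /negPf ->]; last by rewrite andbF scale0r.
rewrite addr0 big1 ?addr0 // => i /negPf ->.
by rewrite big1 // => j _; rewrite scale0r.
Qed.

Lemma skewK (W : lmodType K) (p : 'I_N -> 'I_N -> W) a b :
  unskewing (skewing p) a b = p a b.
Proof.
rewrite -[RHS]sum_delta2 /unskewing /skewing.
under eq_bigr => i _ do under eq_bigr => j _ do rewrite scaler_sumr.
under eq_bigr => i _ do rewrite exchange_big /=.
rewrite exchange_big /=; apply: eq_bigr => c _.
under eq_bigr => i _ do under eq_bigr => j _ do rewrite scaler_sumr.
under eq_bigr => i _ do rewrite exchange_big /=.
rewrite exchange_big /=; apply: eq_bigr => d _.
rewrite andbC [c == a]eq_sym -R_Psi scaler_suml exchange_big /=; apply: eq_bigr => j _.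
rewrite scaler_suml; apply: eq_bigr => i _.
by rewrite scalerA mulrC /Rbar mxE.
Qed.

Lemma unskewK (W : lmodType K) (p : 'I_N -> 'I_N -> W) i j :
  skewing (unskewing p) i j = p i j.
Proof.
rewrite -[RHS]sum_delta2 /unskewing /skewing.
under eq_bigr => a _ do under eq_bigr => b _ do rewrite scaler_sumr.
under eq_bigr => a _ do rewrite exchange_big /=.
rewrite exchange_big /=; apply: eq_bigr => c _.
under eq_bigr => a _ do under eq_bigr => b _ do rewrite scaler_sumr.
under eq_bigr => a _ do rewrite exchange_big /=.
rewrite exchange_big /=; apply: eq_bigr => d _.
rewrite [d == j]eq_sym -Psi_R scaler_suml; apply: eq_bigr => a _.
rewrite scaler_suml; apply: eq_bigr => b _.
by rewrite scalerA mulrC /Rbar mxE.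
Qed.

Lemma skew_eq0 (W : lmodType K) (p : 'I_N -> 'I_N -> W) :
  (forall i j, skewing p i j = 0) -> forall a b, p a b = 0.
Proof.
move=> p0 a b; rewrite -skewK /unskewing big1 // => i _.
by rewrite big1 // => j _; rewrite p0 scaler0.
Qed.

(** The entry of [Rb X_1 Rb^-1 Y_1 Rb] at [⟨i, i'⟩], [⟨j, j'⟩], with [p k c d l] in place of
    [X k c * Y d l], so that it makes sense for vectors as well as for operators. *)
Definition twist (W : lmodType K) (p : 'I_N -> 'I_N -> 'I_N -> 'I_N -> W)
    (i i' j j' : 'I_N) : W :=
  \sum_k \sum_s Rb ⟨i, i'⟩ ⟨k, s⟩ *: \sum_l \sum_t Rb ⟨l, t⟩ ⟨j, j'⟩ *:
    \sum_c \sum_d Ri ⟨c, s⟩ ⟨d, t⟩ *: p k c d l.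

(* [Y_1 Rb X_1 = Rb X_1 Rb^-1 Y_1 Rb] solved for the products [Y i a * X b j]. *)
Definition reorder (W : lmodType K) (p : 'I_N -> 'I_N -> 'I_N -> 'I_N -> W)
    (i a b j : 'I_N) : W :=
  unskewing (fun i' j' => twist p i i' j j') a b.

Lemma eq_reorder (W : lmodType K) (p p' : 'I_N -> 'I_N -> 'I_N -> 'I_N -> W) i a b j :
  (forall k c d l, p k c d l = p' k c d l) -> reorder p i a b j = reorder p' i a b j.
Proof.
move=> e; apply: (congr1 (fun p => reorder p i a b j)).
apply/funext=> k; apply/funext=> c.
by apply/funext=> d; apply/funext=> l.
Qed.

Lemma linear_reorder (W W' : lmodType K) (h : W -> W') (hl : linear h) p i a b j :
  h (reorder p i a b j) = reorder (fun k c d l => h (p k c d l)) i a b j.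
Proof.
pose H : {linear W -> W'} := HB.pack h (GRing.isLinear.Build K _ _ _ h hl).
rewrite -[h]/(H : _ -> _) /reorder /unskewing /twist.
rewrite linear_sum; apply: eq_bigr => i1 _; rewrite linear_sum; apply: eq_bigr => i2 _.
rewrite linearZ; congr (_ *: _).
rewrite linear_sum; apply: eq_bigr => i3 _; rewrite linear_sum; apply: eq_bigr => i4 _.
rewrite linearZ; congr (_ *: _).
rewrite linear_sum; apply: eq_bigr => i5 _; rewrite linear_sum; apply: eq_bigr => i6 _.
rewrite linearZ; congr (_ *: _).
rewrite linear_sum; apply: eq_bigr => i7 _; rewrite linear_sum; apply: eq_bigr => i8 _.
by rewrite linearZ.
Qed.

Lemma reorder_linear (W : lmodType K) e (f g : 'I_N -> 'I_N -> 'I_N -> 'I_N -> W) i a b j :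
  reorder (fun k c d l => e *: f k c d l + g k c d l) i a b j =
  e *: reorder f i a b j + reorder g i a b j.
Proof.
(* Linearity in the family is naturality in the module, applied to this map out of [W * W] and to
   the two projections. *)
pose h (x : (W * W)%type) : W := e *: x.1 + x.2.
have hl : linear h.
  move=> d [x1 x2] [y1 y2]; rewrite /h /= !scalerDr !scalerA [e * d]mulrC.
  by rewrite addrACA.
have l1 : linear (fun x : (W * W)%type => x.1) by [].
have l2 : linear (fun x : (W * W)%type => x.2) by [].
have := linear_reorder hl (fun k c d l => (f k c d l, g k c d l)) i a b j.
by rewrite /h (linear_reorder l1) (linear_reorder l2) => <-.
Qed.

Lemma reorder0 (W : lmodType K) p i a b j :
  (forall k c d l, p k c d l = 0 :> W) -> reorder p i a b j = 0.
Proof.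
move=> p0; have l0 : linear (fun _ : W => 0 : W) by move=> c u v; rewrite scaler0 addr0.
rewrite (eq_reorder (p' := fun _ _ _ _ => 0) i a b j p0).
exact/esym/(linear_reorder l0 (fun _ _ _ _ => 0)).
Qed.

Lemma sandwichE (B : algType K) (P : 'M[K]_(N * N)) (X Y : 'M[B]_N) i i' j j' :
  (L_one Y *m scal_mx B P *m L_one X) ⟨i, i'⟩ ⟨j, j'⟩ =
  \sum_a \sum_b P ⟨a, i'⟩ ⟨b, j'⟩ *: (Y i a * X b j).
Proof.
rewrite mul_mx_tensmx1 exchange_big; apply: eq_bigr => b _.
rewrite mul_tensmx1 mulr_suml; apply: eq_bigr => a _.
by rewrite mxE /= -scalerAr mulr1 -scalerAl.
Qed.

(** Multiplying the cross relation by [Rb] on the right leaves [Y_1 Rb X_1] on one side, whose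
    entries are the skewings of the products [Y i a * X b j]; unskewing solves for these
    products. *)
Lemma crossE (B : algType K) (X Y : 'M[B]_N) :
  cross X Y <->
  forall i a b j, Y i a * X b j = reorder (fun k c d l => X k c * Y d l) i a b j.
Proof.
have E : cross X Y <-> L_one Y *m scal_mx B Rb *m L_one X =
    scal_mx B Rb *m (L_one X *m scal_mx B Ri *m L_one Y *m scal_mx B Rb).
  rewrite /cross /comm_mx /L_two.
  have RK : scal_mx B Ri *m scal_mx B Rb = 1%:M.
    by rewrite -scal_mxM mulVmx ?scal_mx1 // Rbar_unit.
  have KR : scal_mx B Rb *m scal_mx B Ri = 1%:M.
    by rewrite -scal_mxM mulmxV ?scal_mx1 // Rbar_unit.
  split=> [e|e].
    rewrite !mulmxA in e *; rewrite -e -!mulmxA RK mulmx1 //.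
  rewrite !mulmxA in e *; rewrite e -!mulmxA KR mulmx1 //.
have {}E : cross X Y <-> forall i i' j j', skewing (fun a b => Y i a * X b j) i' j' =
    twist (fun k c d l => X k c * Y d l) i i' j j'.
  have tE i i' j j' : (scal_mx B Rb *m (L_one X *m scal_mx B Ri *m L_one Y *m
      scal_mx B Rb)) ⟨i, i'⟩ ⟨j, j'⟩ = twist (fun k c d l => X k c * Y d l) i i' j j'.
    rewrite mul_scal_mx sum_mxtens; apply: eq_bigr => k _; apply: eq_bigr => s _.
    congr (_ *: _); rewrite mul_mx_scal sum_mxtens.
    apply: eq_bigr => l _; apply: eq_bigr => t _; congr (_ *: _).
    exact: sandwichE.
  rewrite E; split=> [e i i' j j'|e]; first by rewrite -tE -e sandwichE.
  by apply: matrix_tensP => i i' j j'; rewrite tE -e sandwichE.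
rewrite E; split=> e i.
  move=> a b j; rewrite -(skewK (fun a b => Y i a * X b j)) /reorder /unskewing.
  by apply: eq_bigr => i' _; apply: eq_bigr => j' _; rewrite e.
move=> i' j j'; rewrite -[RHS](unskewK (fun i' j' => twist _ i i' j j')) /skewing.
by apply: eq_bigr => a _; apply: eq_bigr => b _; rewrite e.
Qed.

End Cross.

(** * Relations in the threefold tensor power *)

Section ThreeFold.
Variables (K : fieldType) (N : nat) (R : 'M[K]_(N * N)).
Local Notation Rb := (Rbar R).
Local Notation Ri := (invmx (Rbar R)).
Hypothesis R_unit : R \in unitmx.
Hypothesis R_braid : R12 R *m R23 R *m R12 R = R23 R *m R12 R *m R23 R.
Variable Psi : 'M[K]_(N * N).
Hypothesis R_Psi : forall i j k l : 'I_N,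
  \sum_a \sum_b entry R i a j b * entry Psi b l a k = ((i == k) && (l == j))%:R.

Lemma castmx_sqM (T : pzRingType) m n (e : m = n) (M M' : 'M[T]_m) :
  castmx (e, e) (M *m M') = castmx (e, e) M *m castmx (e, e) M'.
Proof. by case: n / e. Qed.

Lemma castmx_sq1 (T : pzRingType) m n (e : m = n) :
  castmx (e, e) (1%:M : 'M[T]_m) = 1%:M.
Proof. by case: n / e. Qed.

Lemma castmx_sqB (T : pzRingType) m n (e : m = n) (M M' : 'M[T]_m) :
  castmx (e, e) (M - M') = castmx (e, e) M - castmx (e, e) M'.
Proof. by case: n / e. Qed.

(** The formula of [R12], for entries in a noncommutative algebra. *)
Definition emb12 (B : algType K) (M : 'M[B]_(N * N)) : 'M[B]_(N * (N * N)) :=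
  castmx (esym (mulnA N N N), esym (mulnA N N N)) (M *t (1%:M : 'M_N)).

Definition emb1 (B : algType K) (L : 'M[B]_N) : 'M[B]_(N * (N * N)) :=
  L *t (1%:M : 'M_(N * N)).

Section Embeddings.
Variable B : algType K.

Lemma cast_mxtens_index (i j k : 'I_N) :
  cast_ord (esym (esym (mulnA N N N))) ⟨i, ⟨j, k⟩⟩ = ⟨⟨i, j⟩, k⟩.
Proof. by apply: val_inj => /=; rewrite mulnDl mulnA addnA. Qed.

Lemma emb12E (M : 'M[B]_(N * N)) i j k i' j' k' :
  emb12 M ⟨i, ⟨j, k⟩⟩ ⟨i', ⟨j', k'⟩⟩ = M ⟨i, j⟩ ⟨i', j'⟩ * (k == k')%:R.
Proof. by rewrite castmxE /= !cast_mxtens_index tensmxE mxE. Qed.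

Lemma matrix_tens3P (T : Type) (M M' : 'M[T]_(N * (N * N))) :
  (forall i j k i' j' k', M ⟨i, ⟨j, k⟩⟩ ⟨i', ⟨j', k'⟩⟩ =
                          M' ⟨i, ⟨j, k⟩⟩ ⟨i', ⟨j', k'⟩⟩) -> M = M'.
Proof.
move=> e; apply: matrix_tensP => i s i' s'.
by case: (mxtens_indexP s) => j k; case: (mxtens_indexP s') => j' k'.
Qed.

(** The entries need not commute, so [*t] is not multiplicative in general; with the identity as
    right factor the order of the entries is preserved. *)
Lemma tensmx1M m n p s (M : 'M[B]_(m, n)) (M' : 'M[B]_(n, p)) :
  (M *m M') *t (1%:M : 'M_s) = (M *t 1%:M) *m (M' *t 1%:M).
Proof.
apply: matrix_tensP => i i' j j'; rewrite mul_tensmx1 tensmxE mxE mulr_suml.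
by apply: eq_bigr => a _; rewrite tensmxE mulrA.
Qed.

Lemma emb12M (M M' : 'M[B]_(N * N)) : emb12 (M *m M') = emb12 M *m emb12 M'.
Proof. by rewrite /emb12 tensmx1M castmx_sqM. Qed.

Lemma emb12B (M M' : 'M[B]_(N * N)) : emb12 (M - M') = emb12 M - emb12 M'.
Proof.
rewrite /emb12 -castmx_sqB; congr castmx; apply/matrixP=> i j.
by rewrite !mxE mulrBl.
Qed.

Lemma emb12_L_one (L : 'M[B]_N) : emb12 (L_one L) = emb1 L.
Proof.
apply: matrix_tens3P => i j k i' j' k'.
rewrite emb12E /L_one /emb1 !tensmxE !mxE -mulrA; congr (_ * _).
rewrite -natrM mulnb (can_eq (@mxtens_indexK N N)) //.
Qed.

Lemma emb12_scal (P : 'M[K]_(N * N)) : emb12 (scal_mx B P) = scal_mx B (R12 P).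
Proof.
apply: matrix_tens3P => i j k i' j' k'.
rewrite emb12E !mxE castmxE /= !cast_mxtens_index tensmxE mxE.
by case: (k == k'); rewrite ?mulr1 ?mulr0 // scale0r.
Qed.

Lemma R12M (P Q : 'M[K]_(N * N)) : R12 (P *m Q) = R12 P *m R12 Q.
Proof.
rewrite /R12 -castmx_sqM; congr castmx.
have := @tensmx_mul _ _ _ _ _ _ _ P (1%:M : 'M[K]_N) Q 1%:M.
by rewrite mulmx1 => ->.
Qed.

Lemma R23M (P Q : 'M[K]_(N * N)) : R23 (P *m Q) = R23 P *m R23 Q.
Proof.
rewrite /R23.
have := @tensmx_mul _ _ _ _ _ _ _ (1%:M : 'M[K]_N) P 1%:M Q.
by rewrite mulmx1 => ->.
Qed.

Lemma tens11 m n : (1%:M : 'M[K]_m) *t (1%:M : 'M[K]_n) = 1%:M.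
Proof.
apply: matrix_tensP => i i' j j'; rewrite tensmxE !mxE -natrM mulnb.
by rewrite (can_eq (@mxtens_indexK m n)).
Qed.

Lemma R12_1 : R12 (1%:M : 'M[K]_(N * N)) = 1%:M.
Proof. by rewrite /R12 tens11 castmx_sq1. Qed.

Lemma R23_1 : R23 (1%:M : 'M[K]_(N * N)) = 1%:M.
Proof. exact: tens11. Qed.

(** Transposition reverses products, and both sides of the braid relation are palindromes. *)
Lemma Rbar_braid : R12 Rb *m R23 Rb *m R12 Rb = R23 Rb *m R12 Rb *m R23 Rb.
Proof.
have e12 : R12 Rb = (R12 R)^T by rewrite /R12 trmx_cast /= trmx_tens trmx1.
have e23 : R23 Rb = (R23 R)^T by rewrite /R23 trmx_tens trmx1.
by rewrite e12 e23 -!trmx_mul !mulmxA R_braid.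
Qed.

Local Notation P12 := (scal_mx B (R12 Rb)).
Local Notation P23 := (scal_mx B (R23 Rb)).
Local Notation Q12 := (scal_mx B (R12 Ri)).
Local Notation Q23 := (scal_mx B (R23 Ri)).

Lemma PQ12 : P12 *m Q12 = 1%:M.
Proof. by rewrite -scal_mxM -R12M mulmxV ?Rbar_unit // R12_1 scal_mx1. Qed.
Lemma QP12 : Q12 *m P12 = 1%:M.
Proof. by rewrite -scal_mxM -R12M mulVmx ?Rbar_unit // R12_1 scal_mx1. Qed.
Lemma PQ23 : P23 *m Q23 = 1%:M.
Proof. by rewrite -scal_mxM -R23M mulmxV ?Rbar_unit // R23_1 scal_mx1. Qed.
Lemma QP23 : Q23 *m P23 = 1%:M.
Proof. by rewrite -scal_mxM -R23M mulVmx ?Rbar_unit // R23_1 scal_mx1. Qed.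
Lemma P_braid : P12 *m P23 *m P12 = P23 *m P12 *m P23.
Proof. by rewrite -!scal_mxM Rbar_braid. Qed.

Lemma comm_emb1_R23 (L : 'M[B]_N) (P : 'M[K]_(N * N)) :
  comm_mx (emb1 L) (scal_mx B (R23 P)).
Proof.
rewrite /comm_mx /emb1.
have -> : scal_mx B (R23 P) = 1%:M *t scal_mx B P.
  apply: matrix_tensP => i i' j j'; rewrite tensmxE !mxE !mxtens_indexK /=.
  by case: (i == j); rewrite ?mul1r ?mul0r // scale0r.
apply: matrix_tensP => i i' j j'.
rewrite mul_mx_tensmx1 mul_tensmx1 (bigD1 j) //= [X in _ + X]big1 ?addr0.
  rewrite (bigD1 i) //= [X in _ + X]big1 ?addr0.
    by rewrite !tensmxE !mxE !eqxx !mul1r -scalerAl -scalerAr mulr1 mul1r.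
  by move=> a ai; rewrite tensmxE mxE eq_sym (negPf ai) !mul0r.
by move=> a aj; rewrite tensmxE mxE (negPf aj) mul0r mulr0.
Qed.

Definition second (X : 'M[B]_N) := P12 *m emb1 X *m Q12.
(** The copy of [X] on the third factor. It commutes with [Rb_12], and with [Y_1] as soon as [X] and
    [Y] satisfy the cross relation; hence with every matrix on factors 1 and 2 built from these
    two. *)
Definition third (X : 'M[B]_N) := P23 *m second X *m Q23.

Lemma emb12_L_two X : emb12 (L_two R X) = second X.
Proof. by rewrite /L_two !emb12M !emb12_scal emb12_L_one. Qed.

Lemma comm_second X Y : cross R X Y -> comm_mx (emb1 Y) (second X).
Proof.
move=> e; rewrite /comm_mx -emb12_L_two -emb12_L_one -!emb12M.
by congr emb12.
Qed.

Lemma comm_third X Y : cross R X Y -> comm_mx (emb1 Y) (third X).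
Proof.
move=> /comm_second e; apply: comm_mxM; last exact: comm_emb1_R23.
by apply: comm_mxM => //; exact: comm_emb1_R23.
Qed.

(** The braid relation gives [P P' P X = P' P P' X = P' P X P'], and in the inverse form
    [P' Q Q' = Q Q' P] it then carries the last [P'] through [Q Q']. *)
Lemma conj_swap n (P Q P' Q' X : 'M[B]_n) : P *m Q = 1%:M -> Q *m P = 1%:M ->
  P' *m Q' = 1%:M -> Q' *m P' = 1%:M ->
  P *m P' *m P = P' *m P *m P' -> comm_mx X P' ->
  comm_mx P (P' *m (P *m X *m Q) *m Q').
Proof.
move=> PQ QP PQ' QP' br XP'; rewrite /comm_mx.
have PQr M : M *m P *m Q = M by rewrite -mulmxA PQ mulmx1.
have QPr M : M *m Q *m P = M by rewrite -mulmxA QP mulmx1.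
have PQr' M : M *m P' *m Q' = M by rewrite -mulmxA PQ' mulmx1.
have QPr' M : M *m Q' *m P' = M by rewrite -mulmxA QP' mulmx1.
have br' : Q *m Q' *m Q = Q' *m Q *m Q'.
  transitivity (Q *m Q' *m Q *m (P' *m P *m P') *m (Q' *m Q *m Q')).
    by rewrite !mulmxA PQr' PQr PQr'.
  by rewrite -br !mulmxA QPr QPr' QP mul1mx.
have e : P' *m Q *m Q' = Q *m Q' *m P.
  rewrite -[LHS](QPr) -!mulmxA [Q *m (Q' *m (Q *m P))]mulmxA.
  by rewrite [Q *m Q' *m (Q *m P)]mulmxA br' !mulmxA PQ' mul1mx.
rewrite !mulmxA br -[P' *m P *m P' *m X]mulmxA -XP' !mulmxA.
by rewrite -!mulmxA [P' *m (Q *m Q')]mulmxA e !mulmxA.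
Qed.

Lemma comm_mx_inv n (P Q M : 'M[B]_n) : P *m Q = 1%:M -> Q *m P = 1%:M ->
  comm_mx M P -> comm_mx M Q.
Proof.
move=> PQ QP MP; rewrite /comm_mx -[M *m Q]mul1mx -QP -!mulmxA; congr (_ *m _).
by rewrite mulmxA -MP -mulmxA PQ mulmx1.
Qed.

Lemma comm_third_P12 X : comm_mx (third X) P12.
Proof.
apply: comm_mx_sym; apply: conj_swap; [exact: PQ12|exact: QP12|exact: PQ23|
  exact: QP23|exact: P_braid|exact: comm_emb1_R23].
Qed.

Lemma comm_third_Q12 X : comm_mx (third X) Q12.
Proof. exact: comm_mx_inv PQ12 QP12 (comm_third_P12 X). Qed.

Lemma comm_third_L_one X Y : cross R X Y -> comm_mx (third X) (emb12 (L_one Y)).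
Proof. by rewrite emb12_L_one => e; apply/comm_mx_sym/comm_third. Qed.

Lemma comm_third_L_two X Y : cross R X Y -> comm_mx (third X) (emb12 (L_two R Y)).
Proof.
move=> e; rewrite emb12_L_two; apply: comm_mxM; last exact: comm_third_Q12.
by apply: comm_mxM; [exact: comm_third_P12|apply/comm_mx_sym/comm_third].
Qed.

Lemma comm_third_defect X Y : cross R X Y ->
  comm_mx (third X) (emb12 (mrea_defect R Y)).
Proof.
move=> /comm_third_L_one e; rewrite /mrea_defect /= !(emb12B, emb12M).
have cR : comm_mx (third X) (emb12 (scal_mx B Rb)).
  by rewrite emb12_scal; exact: comm_third_P12.
by do 2![apply: comm_mxB]; do ?[apply: comm_mxM].
Qed.

Lemma comm_third_cross X Y Z : cross R X Y -> cross R X Z ->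
  comm_mx (third X) (emb12 (L_one Y *m L_two R Z - L_two R Z *m L_one Y)).
Proof.
move=> /comm_third_L_one eY /comm_third_L_two eZ.
rewrite emb12B (emb12M (L_one Y)) (emb12M (L_two R Z)).
by apply: comm_mxB; apply: comm_mxM.
Qed.

Lemma R23_entry (P : 'M[K]_(N * N)) a i i' b j j' :
  R23 P ⟨a, ⟨i, i'⟩⟩ ⟨b, ⟨j, j'⟩⟩ = (a == b)%:R * P ⟨i, i'⟩ ⟨j, j'⟩.
Proof. by rewrite tensmxE mxE. Qed.

Lemma R12_entry (P : 'M[K]_(N * N)) a i i' b j j' :
  R12 P ⟨a, ⟨i, i'⟩⟩ ⟨b, ⟨j, j'⟩⟩ = P ⟨a, i⟩ ⟨b, j⟩ * (i' == j')%:R.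
Proof. by rewrite castmxE /= !cast_mxtens_index tensmxE mxE. Qed.

Lemma R12_R23_entry a i i' b j j' :
  (R12 Rb *m R23 Rb) ⟨a, ⟨i, i'⟩⟩ ⟨b, ⟨j, j'⟩⟩ =
  \sum_c Rb ⟨a, i⟩ ⟨b, c⟩ * Rb ⟨c, i'⟩ ⟨j, j'⟩.
Proof.
rewrite mxE sum_mxtens (bigD1 b) //= [X in _ + X]big1 ?addr0 => [|d db].
  rewrite sum_mxtens; apply: eq_bigr => c _; rewrite (bigD1 i') //= [X in _ + X]big1.
    by rewrite addr0 R12_entry R23_entry !eqxx mulr1 mul1r.
  by move=> k ki; rewrite R12_entry eq_sym (negPf ki) mulr0 mul0r.
rewrite sum_mxtens big1 // => c _; rewrite big1 // => k _.
by rewrite R23_entry (negPf db) mul0r mulr0.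
Qed.

Lemma R23_R12_entry a i i' b j j' :
  (R23 Rb *m R12 Rb) ⟨a, ⟨i, i'⟩⟩ ⟨b, ⟨j, j'⟩⟩ =
  \sum_c Rb ⟨i, i'⟩ ⟨c, j'⟩ * Rb ⟨a, c⟩ ⟨b, j⟩.
Proof.
rewrite mxE sum_mxtens (bigD1 a) //= [X in _ + X]big1 ?addr0 => [|d da].
  rewrite sum_mxtens; apply: eq_bigr => c _; rewrite (bigD1 j') //= [X in _ + X]big1.
    by rewrite addr0 R12_entry R23_entry !eqxx mulr1 mul1r.
  by move=> k kj; rewrite R12_entry (negPf kj) !mulr0.
rewrite sum_mxtens big1 // => c _; rewrite big1 // => k _.
by rewrite R23_entry eq_sym (negPf da) !mul0r.
Qed.

Section Kill.
Variables (W : lmodType K) (H : {linear B -> W}).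

Definition killed m n (M : 'M[B]_(m, n)) := forall i j, H (M i j) = 0.

Lemma killed_scall m n p (P : 'M[K]_(m, n)) (M : 'M[B]_(n, p)) :
  killed M -> killed (scal_mx B P *m M).
Proof.
move=> M0 i j; rewrite mul_scal_mx linear_sum big1 // => k _.
by rewrite linearZ /= M0 scaler0.
Qed.

Lemma killed_scalr m n p (M : 'M[B]_(m, n)) (P : 'M[K]_(n, p)) :
  killed M -> killed (M *m scal_mx B P).
Proof.
move=> M0 i j; rewrite mul_mx_scal linear_sum big1 // => k _.
by rewrite linearZ /= M0 scaler0.
Qed.

Lemma killed_emb1_emb12 (X : 'M[B]_N) (E : 'M[B]_(N * N)) (P : 'M[K]_(N * (N * N))) :
  (forall k c a b, H (X k c * E a b) = 0) ->
  killed (emb1 X *m (scal_mx B P *m emb12 E)).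
Proof.
move=> XE i j; case: (mxtens_indexP i) => i1 i'; case: (mxtens_indexP j) => j1 j'.
case: (mxtens_indexP j') => j2 j3.
rewrite mul_tensmx1 linear_sum big1 // => a _; rewrite mul_scal_mx mulr_sumr linear_sum.
rewrite sum_mxtens big1 // => b1 _; rewrite sum_mxtens big1 // => b2 _.
rewrite big1 // => b3 _; rewrite emb12E -scalerAr linearZ mulrA /=.
by case: eqP; rewrite ?mulr1 ?mulr0 ?linear0 ?XE ?scaler0.
Qed.

Lemma killed_emb12_emb1 (X : 'M[B]_N) (E : 'M[B]_(N * N)) (P : 'M[K]_(N * (N * N))) :
  (forall k c a b, H (E a b * X k c) = 0) ->
  killed (emb12 E *m scal_mx B P *m emb1 X).
Proof.
move=> XE i j; case: (mxtens_indexP i) => i1 i'; case: (mxtens_indexP j) => j1 j'.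
case: (mxtens_indexP i') => i2 i3.
rewrite mul_mx_tensmx1 linear_sum big1 // => a _; rewrite mul_mx_scal mulr_suml linear_sum.
rewrite sum_mxtens big1 // => b1 _; rewrite sum_mxtens big1 // => b2 _.
rewrite big1 // => b3 _; rewrite emb12E -scalerAl linearZ /=.
by case: eqP => _; rewrite ?mulr1 ?mulr0 ?mul0r ?linear0 ?XE ?scaler0.
Qed.

Lemma emb12_scal_emb1E (X : 'M[B]_N) (E : 'M[B]_(N * N)) (P : 'M[K]_(N * (N * N)))
    s1 s2 i j1 j :
  H ((emb12 E *m scal_mx B P *m emb1 X) ⟨s1, ⟨s2, i⟩⟩ ⟨j1, j⟩) =
  \sum_b \sum_a1 \sum_a2
    P ⟨a1, ⟨a2, i⟩⟩ ⟨b, j⟩ *: H (E ⟨s1, s2⟩ ⟨a1, a2⟩ * X b j1).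
Proof.
rewrite mul_mx_tensmx1 linear_sum; apply: eq_bigr => b _.
rewrite mul_mx_scal mulr_suml sum_mxtens linear_sum; apply: eq_bigr => a1 _.
rewrite sum_mxtens linear_sum; apply: eq_bigr => a2 _.
rewrite (bigD1 i) //= big1 => [|k ki].
  by rewrite emb12E eqxx mulr1 addr0 -scalerAl linearZ.
by rewrite emb12E eq_sym (negPf ki) mulr0 scaler0 mul0r.
Qed.

Lemma emb1_scal_emb12E (G : 'M[B]_N) (E : 'M[B]_(N * N)) (P : 'M[K]_(N * (N * N)))
    i1 i t1 t2 j :
  H ((emb1 G *m scal_mx B P *m emb12 E) ⟨i1, i⟩ ⟨t1, ⟨t2, j⟩⟩) =
  \sum_a \sum_b1 \sum_b2
    P ⟨a, i⟩ ⟨b1, ⟨b2, j⟩⟩ *: H (G i1 a * E ⟨b1, b2⟩ ⟨t1, t2⟩).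
Proof.
rewrite -mulmxA mul_tensmx1 linear_sum; apply: eq_bigr => a _.
rewrite mul_scal_mx mulr_sumr sum_mxtens linear_sum; apply: eq_bigr => b1 _.
rewrite sum_mxtens linear_sum; apply: eq_bigr => b2 _.
rewrite (bigD1 j) //= big1 => [|k kj].
  by rewrite emb12E eqxx mulr1 addr0 -scalerAr linearZ.
by rewrite emb12E (negPf kj) mulr0 scaler0 mulr0.
Qed.

(** An entry of [Rb_12 Rb_23] is a sum over a single intermediate index, so contracting with this
    product is one skewing after another, and two uses of [skew_eq0] undo it. *)
Lemma skew_skewl (w : 'I_N -> 'I_N -> 'I_N -> W) (i i' j' : 'I_N) :
  skewing R (fun c b' : 'I_N => skewing R (fun a b => w a b b') i c) i' j' =
  \sum_a \sum_b \sum_b' (R12 Rb *m R23 Rb) ⟨a, ⟨i, i'⟩⟩ ⟨b, ⟨b', j'⟩⟩ *: w a b b'.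
Proof.
under [RHS]eq_bigr => a _.
  under eq_bigr => b _.
    under eq_bigr => b' _ do rewrite R12_R23_entry scaler_suml.
    rewrite exchange_big; over.
  rewrite exchange_big; over.
rewrite [RHS]exchange_big; apply: eq_bigr => c _.
under [RHS]eq_bigr => a _ do rewrite exchange_big.
rewrite [RHS]exchange_big; apply: eq_bigr => b' _.
rewrite scaler_sumr; apply: eq_bigr => a _.
by rewrite scaler_sumr; apply: eq_bigr => b _; rewrite scalerA mulrC.
Qed.

Lemma skew_skewr (w : 'I_N -> 'I_N -> 'I_N -> W) (i' j j' : 'I_N) :
  skewing R (fun a' c : 'I_N => skewing R (fun a b => w a a' b) c j) i' j' =
  \sum_b \sum_a \sum_a' (R23 Rb *m R12 Rb) ⟨a, ⟨a', i'⟩⟩ ⟨b, ⟨j, j'⟩⟩ *: w a a' b.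
Proof.
under [RHS]eq_bigr => b _ do rewrite exchange_big.
rewrite [RHS]exchange_big; apply: eq_bigr => a' _.
under [RHS]eq_bigr => b _.
  under eq_bigr => a _ do rewrite R23_R12_entry scaler_suml.
  rewrite exchange_big; over.
rewrite [RHS]exchange_big; apply: eq_bigr => c _.
rewrite [RHS]exchange_big scaler_sumr; apply: eq_bigr => a _.
by rewrite scaler_sumr; apply: eq_bigr => b _; rewrite scalerA.
Qed.

(* [third X] is [Rb_23 Rb_12 X_1] up to scalar matrices on the right, so the entries
   of [E_12 X_3] give those of [E_12 Rb_23 Rb_12 X_1], and skew invertibility,
   applied twice, removes the two R-matrices in the middle. *)
Lemma kill_mulr (X : 'M[B]_N) (E : 'M[B]_(N * N)) :
    comm_mx (third X) (emb12 E) ->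
    (forall k c a b, H (X k c * E a b) = 0) ->
  forall a b k c, H (E a b * X k c) = 0.
Proof.
move=> e XE s b i j; case: (mxtens_indexP b) => {b} a1 a2.
have {e} : killed (emb12 E *m scal_mx B (R23 Rb *m R12 Rb) *m emb1 X).
  have -> : emb12 E *m scal_mx B (R23 Rb *m R12 Rb) *m emb1 X =
    scal_mx B (R23 Rb *m R12 Rb) *m (emb1 X *m (scal_mx B (R12 Ri *m R23 Ri)
      *m emb12 E)) *m scal_mx B (R23 Rb *m R12 Rb).
    transitivity (emb12 E *m third X *m (P23 *m P12)).
      rewrite /third /second scal_mxM !mulmxA -!(mulmxA _ _ P23) QP23 mulmx1.
      by rewrite -!(mulmxA _ _ P12) QP12 mulmx1.
    by rewrite -e /third /second !scal_mxM !mulmxA.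
  by apply: killed_scalr; apply: killed_scall; exact: killed_emb1_emb12.
move=> EX; case: (mxtens_indexP s) => s1 s2.
pose w a a' b := H (E ⟨s1, s2⟩ ⟨a, a'⟩ * X b j).
suff w0 a a' b : w a a' b = 0 by exact: w0.
apply: (skew_eq0 R_Psi (p := fun a b => w a a' b)) => {a b} c j2.
apply: (skew_eq0 R_Psi (p := fun a' c : 'I_N => skewing R (fun a b => w a a' b) c j2)).
move=> {a' c} i3 j3.
have := EX ⟨s1, ⟨s2, i3⟩⟩ ⟨j, ⟨j2, j3⟩⟩.
have := emb12_scal_emb1E X E (R23 Rb *m R12 Rb) s1 s2 i3 j ⟨j2, j3⟩.
by rewrite (skew_skewr w) => <-.
Qed.

(** Mirror image of [kill_mulr]. Here [E_12] is conjugated onto factors 2 and 3, where it commutes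
    with [G_1]; so [G_1 Rb_12 Rb_23 E_12] equals [E_12 S G_1] up to scalar matrices on both sides,
    with [S] scalar, and [H] kills the latter. *)
Lemma kill_mull (G : 'M[B]_N) (E : 'M[B]_(N * N)) :
    comm_mx (emb1 G) (scal_mx B (R12 Rb *m R23 Rb) *m emb12 E
      *m scal_mx B (R23 Ri *m R12 Ri)) ->
    (forall k c a b, H (E a b * G k c) = 0) ->
  forall a b k c, H (G k c * E a b) = 0.
Proof.
move=> e EG s b i a; case: (mxtens_indexP b) => {b} t1 t2.
have {e} : killed (emb1 G *m scal_mx B (R12 Rb *m R23 Rb) *m emb12 E).
  have -> : emb1 G *m scal_mx B (R12 Rb *m R23 Rb) *m emb12 E =
    scal_mx B (R12 Rb *m R23 Rb) *m (emb12 E *m scal_mx B (R23 Ri *m R12 Ri)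
      *m emb1 G) *m scal_mx B (R12 Rb *m R23 Rb).
    rewrite !mulmxA in e *; rewrite -e !scal_mxM !mulmxA.
    by rewrite -!(mulmxA _ _ P12) QP12 mulmx1 -!(mulmxA _ _ P23) QP23 mulmx1.
  by apply: killed_scalr; apply: killed_scall; exact: killed_emb12_emb1.
move=> GE; case: (mxtens_indexP s) => s1 s2.
pose w a b b' := H (G i a * E ⟨b, b'⟩ ⟨t1, t2⟩).
suff w0 b b' : w a b b' = 0 by exact: w0.
apply: (skew_eq0 R_Psi (p := fun a b => w a b b')) => {a b} i2 c.
apply: (skew_eq0 R_Psi (p := fun c b' : 'I_N => skewing R (fun a b => w a b b') i2 c)).
move=> {b' c} i3 j3.
have := GE ⟨i, ⟨i2, i3⟩⟩ ⟨t1, ⟨t2, j3⟩⟩.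
have := emb1_scal_emb12E G E (R12 Rb *m R23 Rb) i ⟨i2, i3⟩ t1 t2 j3.
by rewrite (skew_skewl w) => <-.
Qed.

End Kill.
End Embeddings.
End ThreeFold.

(** * Hecke symmetries and the coproduct matrix *)

Section RingIdentities.
Variable T : pzRingType.
Implicit Types p r x y z : T.

(** [mrea_defect] with [p] for [Rb] and [x] for [L_1]. The ring is a [pzRingType] because it will
    consist of square matrices of size [N * N], and [N] may be 0. *)
Definition re_defect p x := (p * x * p * x - x * p * x * p) - (p * x - x * p).

(* If [p * p = 1 + z * p], then [1 - z * x] turns the inhomogeneous relation
   [re_defect p x = 0] into a homogeneous one. *)
Lemma re_one_sub p x :
  p * (1 - x) * p * (1 - x) - (1 - x) * p * (1 - x) * p
  = (p * x * p * x - x * p * x * p) - (p * p * x - x * (p * p)).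
Proof.
rewrite !(mulrBl, mulrBr, mulr1, mul1r) !mulrA !(opprB, opprD, opprK) !addrA.
by rewrite (ACl ((3*6*7*4)*(1*8)*(2*5))) /= subrr addNr !addr0.
Qed.

(** The case [z = 0], where [p] is an involution. The cross relation yields both [p y p x = x p y p]
    and [y p x p = p x p y], so the mixed terms of the defect of [x + y] cancel in pairs. *)
Lemma re_defect_add p x y : p * p = 1 -> re_defect p x = 0 -> re_defect p y = 0 ->
  y * (p * x * p) = p * x * p * y -> re_defect p (x + y) = 0.
Proof.
move=> pp dx dy xy; rewrite /re_defect.
have pp' a : a * p * p = a by rewrite -mulrA pp mulr1.
have yx : p * y * p * x = x * p * y * p.
  transitivity (p * (y * (p * x * p)) * p); first by rewrite !mulrA pp'.
  by rewrite xy !mulrA pp mul1r.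
have {}xy : y * p * x * p = p * x * p * y by rewrite -xy !mulrA.
rewrite !(mulrDl, mulrDr) yx xy !opprD !opprK !addrA.
transitivity (re_defect p x + re_defect p y); last by rewrite dx dy addr0.
rewrite /re_defect !opprD !opprK !addrA.
rewrite [LHS](ACl ((1*5*9*11)*(4*8*10*12)*((2*7)*(3*6)))) /=.
by rewrite !subrr !addr0 -!addrA.
Qed.

(** The homogeneous reflection equation is stable under products of braided commuting solutions:
    this is the matrix, group-like coproduct of the reflection equation algebra. *)
Lemma re_group_like p r x y : p * r = 1 -> r * p = 1 ->
  p * x * p * x = x * p * x * p -> p * y * p * y = y * p * y * p ->
  y * (p * x * r) = p * x * r * y ->
  p * (x * y) * p * (x * y) = x * y * p * (x * y) * p.
Proof.
move=> pr rp hx hy xy.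
have pr' a : a * p * r = a by rewrite -mulrA pr mulr1.
have rp' a : a * r * p = a by rewrite -mulrA rp mulr1.
transitivity (p * x * (y * (p * x * r)) * p * y).
  by rewrite !mulrA rp'.
rewrite xy !mulrA hx pr'.
transitivity (x * (p * x * r * (p * y * p * y))).
  by rewrite !mulrA rp'.
rewrite hy; transitivity (x * (p * x * r * y) * p * y * p); first by rewrite !mulrA.
by rewrite -xy !mulrA rp'.
Qed.

Lemma re_one_sub_central p x z : (forall a, z * a = a * z) -> p * p = 1 + z * p ->
  p * (1 - z * x) * p * (1 - z * x) - (1 - z * x) * p * (1 - z * x) * p
  = z * z * re_defect p x.
Proof.
move=> zC pp; rewrite re_one_sub /re_defect.
have mz a b : a * (z * b) = z * (a * b) by rewrite mulrA -zC mulrA.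
have -> : p * (z * x) * p * (z * x) = z * z * (p * x * p * x).
  by rewrite -!mulrA !(mz p, mz x).
have -> : z * x * p * (z * x) * p = z * z * (x * p * x * p).
  by rewrite -!mulrA !(mz p, mz x).
(* The Hecke relation makes the linear terms divisible by [z * z], like the quadratic ones. *)
have -> : p * p * (z * x) - z * x * (p * p) = z * z * (p * x - x * p).
  rewrite pp mulrDl mulrDr mul1r mulr1 opprD addrACA subrr add0r mulrBr.
  by rewrite -!mulrA !(mz p, mz x).
by rewrite !mulrBr.
Qed.

(** For invertible [z], the substitution [1 - z x] turns the claim into [re_group_like], and the
    factor [z * z] is then cancelled; [z = 0] is [re_defect_add]. *)
Lemma re_defect_cop p r x y z : (forall a, z * a = a * z) ->
    (z = 0 \/ exists w, w * z = 1) -> p * p = 1 + z * p ->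
    p * r = 1 -> r * p = 1 -> re_defect p x = 0 -> re_defect p y = 0 ->
    y * (p * x * r) = p * x * r * y ->
  re_defect p (x + y - z * x * y) = 0.
Proof.
move=> zC [z0|[w wz]] pp pr rp dx dy xy.
  rewrite z0 !mul0r ?subr0 addr0 in pp *; apply: re_defect_add => //.
  by have rE : r = p by [rewrite -[r]mul1r -pp -mulrA pr mulr1]; rewrite rE in xy.
have mz2 a b : z * a * (z * b) = z * z * (a * b).
  by rewrite -!mulrA [a * (z * _)]mulrA -zC -!mulrA.
have one_cop : 1 - z * (x + y - z * x * y) = (1 - z * x) * (1 - z * y).
  have q : z * x * (z * y) = z * (z * x * y) by rewrite -!mulrA [x * _]mulrA -zC !mulrA.
  rewrite [RHS]mulrBl mul1r [in RHS]mulrBr mulr1 q mulrBr mulrDr !opprB opprD !addrA.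
  by rewrite [LHS](ACl (1*4*2*3)).
have d0 a : re_defect p a = 0 ->
    p * (1 - z * a) * p * (1 - z * a) = (1 - z * a) * p * (1 - z * a) * p.
  by move=> da; apply/eqP; rewrite -subr_eq0 re_one_sub_central // da mulr0.
have zz0 a : z * z * a = 0 -> a = 0.
  move=> /(congr1 ( *%R (w * w))); rewrite mulr0 -!mulrA.
  by rewrite [w * (z * _)]mulrA wz mul1r mulrA wz mul1r.
apply: zz0; rewrite -re_one_sub_central // one_cop; apply/eqP; rewrite subr_eq0; apply/eqP.
apply: (re_group_like pr rp (d0 _ dx) (d0 _ dy)).
have zxC : (1 - z * y) * (p * (1 - z * x) * r) = p * (1 - z * x) * r * (1 - z * y).
  have -> : p * (1 - z * x) * r = 1 - z * (p * x * r).
    by rewrite mulrBr mulr1 mulrBl pr !mulrA zC.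
  have q : z * y * (z * (p * x * r)) = z * (p * x * r) * (z * y).
    by rewrite !mz2 xy.
  rewrite [LHS]mulrBl [RHS]mulrBl !mul1r !mulrBr !mulr1 q !opprB !addrA.
  by rewrite [LHS](ACl (1*4*3*2)).
exact: zxC.
Qed.

End RingIdentities.

(** * Cross relation and reflection equation for the coproduct matrix *)

Section CrossTheory.
Variables (K : fieldType) (N : nat) (R : 'M[K]_(N * N)).
Local Notation Rb := (Rbar R).
Local Notation Ri := (invmx (Rbar R)).
Hypothesis R_unit : R \in unitmx.

Lemma Rbar_sqr q : q != 0 -> (R - q%:M) *m (R + (q^-1)%:M) = 0 ->
  Rb *m Rb = 1%:M + (q - q^-1)%:M *m Rb.
Proof.
move=> q0; rewrite mulmxBl !mulmxDr mul_mx_scalar !mul_scalar_mx scale_scalar_mx divff //.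
move/eqP; rewrite subr_eq0 => /eqP e.
have {e}e : R *m R = 1%:M + (q - q^-1) *: R.
  by rewrite scalerBl addrA [1%:M + _]addrC -e addrK.
by rewrite /Rbar -trmx_mul e linearD /= trmx1 linearZ.
Qed.

Hypothesis R_braid : R12 R *m R23 R *m R12 R = R23 R *m R12 R *m R23 R.

(** Conjugation by [Rb_12 Rb_23] is multiplicative and sends [X_1] to [X_2] and [Rb_12] to [Rb_23].
    Both images commute with [Y_1], hence so does the image of the defect. *)
Lemma comm_emb1_defect (B : algType K) (X Y : 'M[B]_N) : cross R X Y ->
  comm_mx (emb1 Y) (scal_mx B (R12 Rb *m R23 Rb) *m emb12 (mrea_defect R X)
      *m scal_mx B (R23 Ri *m R12 Ri)).
Proof.
pose conj (M : 'M[B]_(N * (N * N))) :=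
  scal_mx B (R12 Rb *m R23 Rb) *m M *m scal_mx B (R23 Ri *m R12 Ri).
have P12K := PQ12 R_unit B; have P23K := PQ23 R_unit B.
have K12P := QP12 R_unit B; have K23P := QP23 R_unit B.
have cK : scal_mx B (R23 Ri *m R12 Ri) *m scal_mx B (R12 Rb *m R23 Rb) = 1%:M.
  by rewrite !scal_mxM mulmxA -(mulmxA _ (scal_mx B (R12 Ri))) K12P mulmx1 K23P.
have conjM M M' : conj (M *m M') = conj M *m conj M'.
  by rewrite /conj !mulmxA -(mulmxA _ _ (scal_mx B (R12 Rb *m R23 Rb))) cK mulmx1.
have conjB M M' : conj (M - M') = conj M - conj M' by rewrite /conj mulmxBr mulmxBl.
have conjX : conj (emb1 X) = second R X.
  rewrite /conj !scal_mxM !mulmxA -(mulmxA _ _ (emb1 X)) -comm_emb1_R23.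
  by rewrite !mulmxA -(mulmxA _ _ (scal_mx B (R23 Ri))) P23K mulmx1.
have conjR : conj (emb12 (scal_mx B Rb)) = scal_mx B (R23 Rb).
  rewrite /conj emb12_scal !scal_mxM !mulmxA P_braid //.
  by rewrite -(mulmxA _ _ (scal_mx B (R23 Ri))) P23K mulmx1 -mulmxA P12K mulmx1.
move=> /(comm_second) XY; rewrite -/(conj _) /mrea_defect /=.
rewrite !(emb12B, emb12M) !(conjB, conjM) emb12_L_one conjX conjR.
have c1 := comm_emb1_R23 Y Rb.
by apply: comm_mxB; apply: comm_mxB; repeat (first [exact: XY|exact: c1|apply: comm_mxM]).
Qed.

Variable B : algType K.
Implicit Types X Y : 'M[B]_N.

Definition sc n (z : K) : 'M[B]_n := scal_mx B z%:M.

Lemma scC m n (z : K) (M : 'M[B]_(m, n)) : sc m z *m M = M *m sc n z.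
Proof.
apply/matrixP=> i j; rewrite mul_scal_mx mul_mx_scal.
rewrite (bigD1 i) //= [in RHS](bigD1 j) //= !mxE !eqxx !big1 // => k kj.
  by rewrite mxE (negPf kj) scale0r.
by rewrite mxE eq_sym (negPf kj) scale0r.
Qed.

(* The matrix of [Delta L]; [1 - z (cop X Y) = (1 - z X) (1 - z Y)]. *)
Definition cop (z : K) X Y : 'M[B]_N := X + Y - sc N z *m X *m Y.

Lemma copE z X Y i j : cop z X Y i j = X i j + Y i j - z *: \sum_k X i k * Y k j.
Proof.
rewrite !mxE; congr (_ - _); rewrite scaler_sumr; apply: eq_bigr => k _.
rewrite mul_scal_mx (bigD1 i) //= mxE eqxx big1 ?addr0 -?scalerAl // => l li.
by rewrite mxE eq_sym (negPf li) scale0r.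
Qed.

Lemma L_oneM X Y : L_one (X *m Y) = L_one X *m L_one Y.
Proof. exact: tensmx1M. Qed.

Lemma L_oneD X Y : L_one (X + Y) = L_one X + L_one Y.
Proof. by apply/matrixP=> i j; rewrite !mxE mulrDl. Qed.

Lemma L_oneN X : L_one (- X) = - L_one X.
Proof. by apply/matrixP=> i j; rewrite !mxE mulNr. Qed.

Lemma L_one_sc z : L_one (sc N z) = sc (N * N) z.
Proof.
apply: matrix_tensP => i i' j j'; rewrite tensmxE !mxE.
rewrite (can_eq (@mxtens_indexK N N)) xpair_eqE /=.
by case: (i == j); case: (i' == j'); rewrite /= ?mulr1 ?mulr0 ?mul0r // !scale0r ?mul0r.
Qed.

Lemma L_one_cop z X Y :
  L_one (cop z X Y) = L_one X + L_one Y - sc (N * N) z *m L_one X *m L_one Y.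
Proof. by rewrite /cop !(L_oneD, L_oneN, L_oneM) L_one_sc. Qed.

Lemma L_two_cop z X Y : L_two R (cop z X Y) =
  L_two R X + L_two R Y - sc (N * N) z *m L_two R X *m L_two R Y.
Proof.
rewrite /L_two L_one_cop mulmxBr mulmxDr mulmxBl mulmxDl; congr (_ - _).
rewrite !mulmxA -scC -[in RHS](mulmxA _ (scal_mx B Ri)).
by rewrite -scal_mxM mulVmx ?Rbar_unit // scal_mx1 mulmx1.
Qed.

Lemma cross0r X : cross R X 0.
Proof.
have L0 : L_one (0 : 'M[B]_N) = 0 by exact: tens0mx.
by rewrite /cross /comm_mx L0 mul0mx mulmx0.
Qed.

Lemma cross0l Y : cross R 0 Y.
Proof.
have L0 : L_one (0 : 'M[B]_N) = 0 by exact: tens0mx.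
by rewrite /cross /comm_mx /L_two L0 !(mulmx0, mul0mx).
Qed.

Lemma cross_copr z X Y Y' : cross R X Y -> cross R X Y' -> cross R X (cop z Y Y').
Proof.
rewrite /cross L_one_cop => c c'; apply: comm_mx_sym.
apply: comm_mxB; first by apply: comm_mxD; exact: comm_mx_sym.
apply: comm_mxM; last exact: comm_mx_sym.
by apply: comm_mxM; [rewrite /comm_mx scC|exact: comm_mx_sym].
Qed.

Lemma cross_copl z X X' Y : cross R X Y -> cross R X' Y -> cross R (cop z X X') Y.
Proof.
rewrite /cross L_two_cop => c c'; apply: comm_mxB; first exact: comm_mxD.
by do 2![apply: comm_mxM => //]; rewrite /comm_mx scC.
Qed.

Lemma mrea_defect_cop z X Y : Rb *m Rb = 1%:M + z%:M *m Rb -> cross R X Y ->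
  mrea_defect R X = 0 -> mrea_defect R Y = 0 -> mrea_defect R (cop z X Y) = 0.
Proof.
move=> RR XY dX dY.
rewrite -[LHS]/(re_defect (scal_mx B Rb) (L_one (cop z X Y))) L_one_cop.
have [RiR RRi] : scal_mx B Ri *m scal_mx B Rb = 1%:M /\ scal_mx B Rb *m scal_mx B Ri = 1%:M.
  by rewrite -!scal_mxM mulVmx ?mulmxV ?Rbar_unit // scal_mx1.
apply: (@re_defect_cop _ _ (scal_mx B Ri)) => //.
- by move=> M; exact: scC.
(* A scalar matrix over a field is zero or invertible, which is the alternative demanded by
   [re_defect_cop]. *)
- have [->|z0] := eqVneq z 0; [left|right; exists (sc (N * N) z^-1)].
    by apply/matrixP=> i j; rewrite !mxE /= mul0rn scale0r.
  rewrite -[LHS]scal_mxM mul_scalar_mx scale_scalar_mx mulVf //.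
  exact: scal_mx1.
- by rewrite -[LHS]scal_mxM RR [LHS]map_mxD [X in X + _]scal_mx1; congr (_ + _); exact: scal_mxM.
Qed.

End CrossTheory.

(** * Extension of operators from M to A ⊗ M *)

Section Linearity.
Variables (K : fieldType).
Implicit Types U V W : lmodType K.

Section LinearFor.
Variables (U V : lmodType K) (f : U -> V).
Hypothesis fl : linear f.

Lemma linear_forD u v : f (u + v) = f u + f v.
Proof. by rewrite -[u]scale1r fl !scale1r. Qed.

Lemma linear_forZ c u : f (c *: u) = c *: f u.
Proof. by rewrite -[c *: u]addr0 fl linear_for0 // addr0. Qed.

Lemma linear_forB u v : f (u - v) = f u - f v.
Proof. by rewrite linear_forD -scaleN1r linear_forZ scaleN1r. Qed.

Lemma linear_for_sum (I : Type) (r : seq I) (P : pred I) (F : I -> U) :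
  f (\sum_(i <- r | P i) F i) = \sum_(i <- r | P i) f (F i).
Proof. exact: (big_morph f linear_forD (linear_for0 fl)). Qed.

End LinearFor.

Lemma linear_comp U V W (f : V -> W) (g : U -> V) :
  linear f -> linear g -> linear (fun u => f (g u)).
Proof. by move=> fl gl c u v; rewrite gl fl. Qed.

Lemma linear_mull (A : algType K) (a : A) : linear (fun x : A => a * x).
Proof. by move=> c u v; rewrite mulrDr scalerAr. Qed.

Lemma linear_mulr (A : algType K) (a : A) : linear (fun x : A => x * a).
Proof. by move=> c u v; rewrite mulrDl scalerAl. Qed.

Lemma eq_tensor_lift U V W (f g : U -> V -> W) t :
  (forall u v, f u v = g u v) -> tensor_lift f t = tensor_lift g t.
Proof. by move=> e; congr tensor_lift; apply/funext => u; apply/funext => v. Qed.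

Section TensorMap.
Variables (U V U' V' : lmodType K) (f : U -> U') (g : V -> V').
Hypotheses (fl : linear f) (gl : linear g).

Lemma tensor_map_linear : linear (tensor_map f g).
Proof.
apply: tensor_lift_linear => [v|u].
  exact: (linear_comp (tens_linearl (U:=U') (g v)) fl).
exact: (linear_comp (tens_linearr (V:=V') (f u)) gl).
Qed.

Lemma tensor_mapE u v : tensor_map f g (u ⊗ v) = f u ⊗ g v.
Proof.
apply: tensor_liftE => [v'|u'].
  exact: (linear_comp (tens_linearl (U:=U') (g v')) fl).
exact: (linear_comp (tens_linearr (V:=V') (f u')) gl).
Qed.

End TensorMap.
End Linearity.

Section Intertwining.
Variables (K : fieldType) (N : nat) (R : 'M[K]_(N * N)).
Variables (W W' : lmodType K) (w0 : W) (w0' : W').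
Hypotheses (w0_neq0 : w0 != 0) (w0'_neq0 : w0' != 0).
Local Notation E := (endo w0_neq0).
Local Notation E' := (endo w0'_neq0).
Variable f : W -> W'.
Hypothesis fl : linear f.

Definition intertwine m n (M : 'M[E]_(m, n)) (M' : 'M[E']_(m, n)) :=
  forall i j w, f (M i j w) = M' i j (f w).

Lemma intertwine_mul m n p (M : 'M[E]_(m, n)) (P : 'M[E]_(n, p)) M' P' :
  intertwine M M' -> intertwine P P' -> intertwine (M *m P) (M' *m P').
Proof.
move=> eM eP i j w; rewrite !mxE !endo_sumE linear_for_sum //.
by apply: eq_bigr => k _; rewrite !endoME eM eP.
Qed.

Lemma intertwine_sub m n (M P : 'M[E]_(m, n)) M' P' :
  intertwine M M' -> intertwine P P' -> intertwine (M - P) (M' - P').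
Proof.
by move=> eM eP i j w; rewrite !mxE !endoE linear_forB // eM eP.
Qed.

Lemma intertwine_scal m n (P : 'M[K]_(m, n)) :
  intertwine (scal_mx E P) (scal_mx E' P).
Proof. by move=> i j w; rewrite !mxE /= linear_forZ. Qed.

Lemma intertwine_L_one (M : 'M[E]_N) M' :
  intertwine M M' -> intertwine (L_one M) (L_one M').
Proof.
move=> eM i j w; rewrite !mxE !endoME eM.
by case: (_ == _); rewrite ?endoE // linear_for0.
Qed.

Lemma intertwine_L_two (M : 'M[E]_N) M' :
  intertwine M M' -> intertwine (L_two R M) (L_two R M').
Proof.
move=> eM; apply: intertwine_mul; last exact: intertwine_scal.
by apply: intertwine_mul; [exact: intertwine_scal|exact: intertwine_L_one].
Qed.

Lemma intertwine_defect (M : 'M[E]_N) M' :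
  intertwine M M' -> intertwine (mrea_defect R M) (mrea_defect R M').
Proof.
move=> /intertwine_L_one eM; have eR := intertwine_scal (Rbar R).
by apply: intertwine_sub; apply: intertwine_sub;
  repeat (first [exact: eM|exact: eR|apply: intertwine_mul]).
Qed.

Lemma intertwine_cop z (M P : 'M[E]_N) M' P' :
  intertwine M M' -> intertwine P P' -> intertwine (cop z M P) (cop z M' P').
Proof.
move=> eM eP i j w; rewrite !copE !endoE linear_forB // linear_forD //.
rewrite linear_forZ // linear_for_sum // eM eP; congr (_ - _ *: _).
by apply: eq_bigr => k _; rewrite !endoME eM eP.
Qed.

End Intertwining.

(** * Left multiplication of A on A ⊗ M *)

Section LeftAction.
Variables (K : fieldType) (N : nat) (R : 'M[K]_(N * N)).
Variables (A : algType K) (L : 'M[A]_N).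
Hypothesis A_univ : presented R L.

Lemma counit_exists : exists eps : {lrmorphism A -> K^o}, forall i j, eps (L i j) = 0.
Proof.
have d0 : mrea_defect R (0 : 'M[K^o]_N) = 0.
  by rewrite /mrea_defect /= /L_one tens0mx !(mulmx0, mul0mx, subr0).
have [eps epsE] := presented_lift A_univ d0.
by exists eps => i j; rewrite epsE mxE.
Qed.

Variables (M : lmodType K) (m0 : M).
Hypothesis m0_neq0 : m0 != 0.
Local Notation AM := (tensor A M).

(** The counit, available this early because the zero matrix solves the reflection equation, maps
    [1 ⊗ m0] to [m0]. The bound is what allows the endomorphisms of [A ⊗ M] to be a ring of the
    library. *)
Lemma tens_neq0 : (1 : A) ⊗ m0 != 0.
Proof.
have [eps _] := counit_exists.
have fl (v : M) : linear (fun a : A => (eps a : K) *: v).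
  by move=> c a b; rewrite linearP /= scalerDl scalerA.
have fr (a : A) : linear (fun v : M => (eps a : K) *: v).
  by move=> c u v; rewrite scalerDr !scalerA mulrC.
apply/eqP => /(congr1 (tensor_lift (fun (a : A) v => (eps a : K) *: v))).
rewrite tensor_liftE // linear_for0; last exact: tensor_lift_linear.
by rewrite rmorph1 scale1r; exact/eqP.
Qed.

Local Notation E := (endo tens_neq0).

Definition left_op (a : A) : E :=
  Endo tens_neq0 (tensor_map_linear (linear_mull (A := A) a) (g := @id M) (fun _ _ _ => erefl)).

Lemma left_opE a (c : A) (x : M) : left_op a (c ⊗ x) = (a * c) ⊗ x.
Proof. by apply: tensor_mapE => //; exact: linear_mull. Qed.

Lemma left_op_morphism : exists phi : {lrmorphism A -> E}, phi =1 left_op.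
Proof.
have eqE (g h : E) : (forall (c : A) (x : M), g (c ⊗ x) = h (c ⊗ x)) -> g = h.
  move=> e; apply: endoP; apply: tensor_mor_ext e; exact: endo_linear.
have fl : linear left_op.
  move=> c a b; apply: eqE => d x; rewrite endoDE endoZE !left_opE mulrDl -scalerAl.
  exact: tens_linearl.
have fM : monoid_morphism left_op.
  split=> [|a b]; apply: eqE => c x; first by rewrite left_opE mul1r.
  by rewrite endoME !left_opE mulrA.
pose m1 := GRing.isLinear.Build K A E *:%R left_op fl.
pose m2 := GRing.isMonoidMorphism.Build A E left_op fM.
pose phi : {lrmorphism A -> E} := HB.pack left_op m1 m2.
by exists phi.
Qed.

Definition left_mx : 'M[E]_N := \matrix_(i, j) left_op (L i j).

Lemma left_mxE i j c x : left_mx i j (c ⊗ x) = (L i j * c) ⊗ x.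
Proof. by rewrite mxE left_opE. Qed.

Lemma mrea_defect_left_mx : mrea_defect R left_mx = 0.
Proof.
have [phi phiE] := left_op_morphism.
have -> : left_mx = map_mx phi L by apply/matrixP=> i j; rewrite mxE [RHS]mxE phiE.
rewrite -(map_mrea_defect phi) (presented_defect A_univ).
by apply/matrixP=> i j; rewrite [LHS]mxE !mxE linear0.
Qed.

End LeftAction.

(** * Existence of the extended operators *)

Section Extension.
Variables (K : fieldType) (N : nat) (R : 'M[K]_(N * N)).
Hypothesis R_unit : R \in unitmx.
Hypothesis R_braid : R12 R *m R23 R *m R12 R = R23 R *m R12 R *m R23 R.
Variable Psi : 'M[K]_(N * N).
Hypothesis R_Psi : forall i j k l : 'I_N,
  \sum_a \sum_b entry R i a j b * entry Psi b l a k = ((i == k) && (l == j))%:R.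
Hypothesis Psi_R : forall i j k l : 'I_N,
  \sum_a \sum_b entry Psi i a j b * entry R b l a k = ((i == k) && (l == j))%:R.
Variables (A : algType K) (L : 'M[A]_N).
Hypothesis A_univ : presented R L.
Local Notation reorder := (reorder R Psi).

Section Hat.
Variables (W : lmodType K) (w0 : W) (w0_neq0 : w0 != 0).
Variable X : 'M[endo w0_neq0]_N.

Local Notation WF := (W * {ffun 'I_N * 'I_N -> W})%type.

(* The entries of [L] act on the second component of [W * {ffun _}] so that the
   coordinates of that component, seen as operators, satisfy the cross relation
   with [X]: a family of vectors of [W] can then be moved past a whole word. *)
Definition hat_fun (b j : 'I_N) (v : WF) : WF :=
  (X b j v.1, [ffun p => reorder (fun k c d l => X k c (v.2 (d, l))) p.1 p.2 b j]).

Lemma hat_linear b j : linear (hat_fun b j).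
Proof.
move=> e u v; rewrite /hat_fun; congr pair; first by rewrite /= linearP.
rewrite /=; apply/ffunP => p.
rewrite [LHS]ffunE [RHS]ffunE [X in _ = X + _]ffunE [X in _ = _ *: X + _]ffunE
  [X in _ = _ + X]ffunE.
rewrite -reorder_linear.
apply: eq_reorder => k c d l.
by rewrite ffunE [X in X + _]ffunE linearP.
Qed.

Definition slot_fun (i a : 'I_N) (v : WF) : WF := (v.2 (i, a), 0).

Lemma slot_linear i a : linear (slot_fun i a).
Proof.
move=> e u v; rewrite /slot_fun; congr pair; first by rewrite /= !ffunE.
by rewrite /= scaler0 addr0.
Qed.

Lemma hat_neq0 : (w0, 0) != 0 :> WF.
Proof. by apply/eqP => -[/eqP]; exact/negP/w0_neq0. Qed.

Definition hat_mx : 'M[endo hat_neq0]_N := \matrix_(b, j) Endo hat_neq0 (hat_linear b j).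
Definition slot_mx : 'M[endo hat_neq0]_N := \matrix_(i, a) Endo hat_neq0 (slot_linear i a).

Lemma hat_mxE b j v : hat_mx b j v = hat_fun b j v. Proof. by rewrite mxE. Qed.
Lemma slot_mxE i a v : slot_mx i a v = slot_fun i a v. Proof. by rewrite mxE. Qed.

Lemma linear_pair0 : linear (fun w : W => (w, 0) : WF).
Proof. by move=> c u v; congr pair; rewrite /= scaler0 addr0. Qed.

Lemma hat_pair0 b j w : hat_mx b j (w, 0) = (X b j w, 0).
Proof.
rewrite hat_mxE /hat_fun; congr pair; apply/ffunP => p; rewrite !ffunE reorder0 // => k c d l.
by rewrite /= ffunE linear0.
Qed.

(** The second component of [hat_fun] was chosen as the right-hand side of [crossE]; since [slot_mx]
    lands in [W * 0], where [hat_mx] acts as [X], nothing else is left. *)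
Lemma cross_hat_slot : cross R hat_mx slot_mx.
Proof.
apply/(crossE R_unit R_Psi Psi_R) => i a b j; apply: endoP => v.
have el : linear (fun f : endo hat_neq0 => f v) by [].
rewrite (linear_reorder R Psi el) endoME slot_mxE hat_mxE /slot_fun /= ffunE /=.
apply: etrans (linear_reorder R Psi linear_pair0 (fun k c d l => X k c (v.2 (d, l))) i a b j) _.
apply: eq_reorder => k c d l.
by rewrite /= slot_mxE hat_pair0.
Qed.

Hypothesis X0 : mrea_defect R X = 0.

(** The first component of the defect [D] is the defect of [X]. As [D] also vanishes on [W * 0], it
    vanishes after every slot; [kill_mull] gives the same for a slot applied after [D], and these
    composites read off the second component. *)
Lemma mrea_defect_hat : mrea_defect R hat_mx = 0.
Proof.
apply/matrixP => s t; rewrite [RHS]mxE; set D := mrea_defect R hat_mx.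
have D_pair a b w : D a b (w, 0) = 0.
  have h : intertwine (fun w => (w, 0) : WF) X hat_mx by move=> i j u; rewrite hat_pair0.
  have := intertwine_defect R linear_pair0 h a b w.
  by rewrite X0 mxE => <-.
have GD a b k c : slot_mx k c * D a b = 0.
  have := kill_mull R_unit R_Psi (H := idfun) (comm_emb1_defect R_unit R_braid cross_hat_slot).
  apply=> {a b k c} k c a b; apply: endoP => v.
  by rewrite /= slot_mxE /slot_fun D_pair.
apply: endoP => v; rewrite [RHS]surjective_pairing [LHS]surjective_pairing; congr pair.
  have h : intertwine (fun v : WF => v.1) hat_mx X by move=> i j u; rewrite hat_mxE.
  have := intertwine_defect R (f := fun v : WF => v.1) (fun _ _ _ => erefl) h s t v.
  by rewrite X0 => ->; rewrite mxE.
apply/ffunP => -[i a]; rewrite [RHS]ffunE.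
have /(congr1 fst) : (slot_mx i a * D s t) v = 0 by rewrite GD.
by rewrite endoME slot_mxE.
Qed.

(** [F i a c x] is the result of moving the operator [u i a] past [c]. It depends only on the
    element [c], not on a word representing it, because [hat_mx] satisfies the reflection
    equation. *)
Lemma slide_exists (M : lmodType K) (u : 'I_N -> 'I_N -> M -> W) :
    (forall i a, linear (u i a)) ->
  exists F : 'I_N -> 'I_N -> A -> M -> W,
    [/\ forall i a x, linear ((F i a)^~ x), forall i a c, linear (F i a c),
        forall i a x, F i a 1 x = u i a x
      & forall i a b j c x, F i a (L b j * c) x =
          reorder (fun k c' d l => X k c' (F d l c x)) i a b j].
Proof.
move=> ul; have [phi phiL] := presented_lift A_univ mrea_defect_hat.
(* The first component is a dummy: [hat_fun] never lets it reach the second one. *)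
pose v x : WF := (0, [ffun p => u p.1 p.2 x]).
have vl : linear v.
  move=> c x y; rewrite /v; congr pair; first by rewrite /= scaler0 addr0.
  by apply/ffunP => p; rewrite !ffunE ul.
exists (fun i a c x => (phi c (v x)).2 (i, a)); split=> [i a x|i a c|i a x|i a b j c x].
- by move=> d c c'; rewrite linearP endoDE endoZE /= !ffunE.
- by move=> d x y; rewrite vl linearP /= !ffunE.
- by rewrite rmorph1 /= ffunE.
- by rewrite rmorphM /= phiL hat_mxE /= ffunE.
Qed.

End Hat.

Section Def.
Variables (M : lmodType K) (m0 : M) (m0_neq0 : m0 != 0).
Local Notation AM := (tensor A M).
Local Notation nz := (tens_neq0 A_univ m0_neq0).
Local Notation X := (left_mx A_univ m0_neq0).
Implicit Type m : 'M[endo m0_neq0]_N.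

(* [mt] is the action of [1 ⊗ m] in the braided tensor product. *)
Definition is_ext m (mt : 'M[endo nz]_N) : Prop :=
  cross R X mt /\ forall i j x, mt i j ((1 : A) ⊗ x) = (1 : A) ⊗ m i j x.

(** The operators [1 ⊗ m i a] are slid past the first tensor factor by [slide_exists], with [X] left
    multiplication; the recursion for [F] is the cross relation evaluated at [c ⊗ x]. *)
Lemma ext_exists m : exists mt, is_ext m mt.
Proof.
have ul i a : linear (fun x => (1 : A) ⊗ m i a x).
  exact: (linear_comp (tens_linearr (V := M) (1 : A)) (endo_linear (m i a))).
have [F [Fl Fr F1 FM]] := slide_exists (mrea_defect_left_mx A_univ m0_neq0) ul.
pose mt : 'M[endo nz]_N := \matrix_(i, a) Endo nz (tensor_lift_linear (Fl i a) (Fr i a)).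
have mtE i a c x : mt i a (c ⊗ x) = F i a c x by rewrite mxE; exact: tensor_liftE.
exists mt; split=> [|i j x]; last by rewrite mtE F1.
apply/(crossE R_unit R_Psi Psi_R) => i a b j; apply: endoP.
apply: tensor_mor_ext => [||c x]; [exact: endo_linear|exact: endo_linear|].
have el : linear (fun f : endo nz => f (c ⊗ x)) by [].
rewrite (linear_reorder R Psi el) endoME left_mxE mtE FM.
apply: eq_reorder => k c' d l.
by rewrite -mtE.
Qed.

End Def.
End Extension.

(** * Uniqueness of the extension and transport of relations *)

Section ExtensionTheory.
Variables (K : fieldType) (N : nat) (R : 'M[K]_(N * N)).
Hypothesis R_unit : R \in unitmx.
Hypothesis R_braid : R12 R *m R23 R *m R12 R = R23 R *m R12 R *m R23 R.
Variable Psi : 'M[K]_(N * N).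
Hypothesis R_Psi : forall i j k l : 'I_N,
  \sum_a \sum_b entry R i a j b * entry Psi b l a k = ((i == k) && (l == j))%:R.
Hypothesis Psi_R : forall i j k l : 'I_N,
  \sum_a \sum_b entry Psi i a j b * entry R b l a k = ((i == k) && (l == j))%:R.
Variables (A : algType K) (L : 'M[A]_N).
Hypothesis A_univ : presented R L.
Variables (M : lmodType K) (m0 : M) (m0_neq0 : m0 != 0).
Local Notation AM := (tensor A M).
Local Notation nz := (tens_neq0 A_univ m0_neq0).
Local Notation X := (left_mx A_univ m0_neq0).
Implicit Types m n : 'M[endo m0_neq0]_N.
Implicit Types mt nt : 'M[endo nz]_N.

Lemma tensor_left_ind (P : AM -> Prop) :
    P 0 -> (forall c t t', P t -> P t' -> P (c *: t + t')) ->
    (forall x, P ((1 : A) ⊗ x)) -> (forall i j t, P t -> P (X i j t)) ->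
  forall t, P t.
Proof.
move=> P0 PD P1 PX; apply: tensor_ind => // e c x t Pt; apply: (PD) => // {e t Pt}.
apply: (presented_ind A_univ (P := fun c : A => P (c ⊗ x))) => [|e {}c d Pc Pd|i j {}c Pc].
- exact: P1.
- have -> : (e *: c + d) ⊗ x = e *: (c ⊗ x) + d ⊗ x by exact: tens_linearl.
  exact: PD.
- by rewrite -(left_mxE A_univ m0_neq0); exact: PX.
Qed.

(** The cross relation moves [mt] past every [X], so [mt] is determined by its values on [1 ⊗ M].
    With an arbitrary intertwiner [h] as target, this one statement yields the commutation of left
    and right actions, coassociativity and the counit laws. *)
Lemma ext_universal (W : lmodType K) (w0 : W) (w0_neq0 : w0 != 0)
    (X' Y' : 'M[endo w0_neq0]_N) (h : AM -> W) m mt : linear h -> is_ext m mt ->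
    intertwine h X X' -> cross R X' Y' ->
    (forall i j x, h (1 ⊗ m i j x) = Y' i j (h (1 ⊗ x))) ->
  intertwine h mt Y'.
Proof.
move=> hl [XY m1] hX /(crossE R_unit R_Psi Psi_R) cX'Y' h1 i j t.
move: i j; elim/tensor_left_ind: t => [i j|c t t' ht ht' i j|x i j|b j t ht i a].
- by rewrite !(linear_for0 (endo_linear _)) linear_for0 // (linear_for0 (endo_linear _)).
- by rewrite (endo_linear (mt i j)) !hl (endo_linear (Y' i j)) ht ht'.
- by rewrite m1.
have e : mt i a * X b j = reorder R Psi (fun k c d l => X k c * mt d l) i a b j.
  by move: i a b j {ht}; exact/(crossE R_unit R_Psi Psi_R).
have el : linear (fun f : endo nz => f t) by [].
rewrite -[mt i a (X b j t)]/((mt i a * X b j) t) e.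
rewrite (linear_reorder R Psi el) (linear_reorder R Psi hl).
rewrite hX -[RHS]/((Y' i a * X' b j) (h t)) cX'Y'.
have el' : linear (fun f : endo w0_neq0 => f (h t)) by [].
rewrite (linear_reorder R Psi el'); apply: eq_reorder => k c d l.
by rewrite hX ht.
Qed.

(** Induction along [X]: if all entries of [E] kill [t], then [X E] kills [t], and [kill_mulr] for
    evaluation at [t] turns this into [E X]. Applied to a defect or a commutator, it transports the
    relation from [M] to [A ⊗ M]. *)
Lemma ext_kill (E : 'M[endo nz]_(N * N)) : comm_mx (third R X) (emb12 E) ->
  (forall a b x, E a b (1 ⊗ x) = 0) -> E = 0.
Proof.
move=> XE E1; apply/matrixP=> a b; rewrite mxE; apply: endoP => t.
rewrite endo0E; move: a b; elim/tensor_left_ind: t => [a b|c t t' Et Et' a b|x a b|k c t Et a b].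
- by rewrite (linear_for0 (endo_linear _)).
- by rewrite (endo_linear (E a b)) Et Et' scaler0 addr0.
- exact: E1.
rewrite -[LHS]/(endo_eval t (E a b * X k c)); apply: (kill_mulr R_unit R_Psi (H := endo_eval t) XE).
move=> {k c a b} k c a b; rewrite -[LHS]/(X k c (E a b t)) Et.
exact: linear_for0 (endo_linear _).
Qed.

Lemma ext_intertwine m mt : is_ext m mt -> intertwine (fun x => (1 : A) ⊗ x) m mt.
Proof. by case=> _ m1 i j x; rewrite m1. Qed.

Lemma ext_defect m mt : is_ext m mt -> mrea_defect R m = 0 -> mrea_defect R mt = 0.
Proof.
move=> me m0'; apply: ext_kill.
  by apply: comm_third_defect => //; case: me.
move=> a b x; have l1 := tens_linearr (V := M) (1 : A).
have := intertwine_defect R l1 (ext_intertwine me) a b x.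
by rewrite m0' mxE => <-; exact: linear_for0.
Qed.

Lemma ext_cross m n mt nt : is_ext m mt -> is_ext n nt -> cross R m n -> cross R mt nt.
Proof.
move=> me ne mn; apply/eqP; rewrite -subr_eq0; apply/eqP/ext_kill.
  by apply: comm_third_cross => //; [case: ne|case: me].
move=> a b x; have l1 := tens_linearr (V := M) (1 : A).
have em := ext_intertwine me; have en := ext_intertwine ne.
have em2 := intertwine_L_two R l1 em; have en1 := intertwine_L_one l1 en.
have := intertwine_sub l1 (intertwine_mul l1 en1 em2) (intertwine_mul l1 em2 en1) a b x.
rewrite (_ : _ - _ = 0); last by apply/eqP; rewrite subr_eq0; apply/eqP.
by rewrite mxE => <-; exact: linear_for0.
Qed.

Lemma ext_cop z m n mt nt : is_ext m mt -> is_ext n nt ->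
  is_ext (cop z m n) (cop z mt nt).
Proof.
move=> me ne; split; first by apply: cross_copr; [case: me|case: ne].
move=> i j x; have l1 := tens_linearr (V := M) (1 : A).
by have := intertwine_cop l1 z (ext_intertwine me) (ext_intertwine ne) i j x.
Qed.

End ExtensionTheory.

(** * The braided tensor square *)

Section BraidedSquare.
Variables (K : fieldType) (N : nat) (R : 'M[K]_(N * N)).
Hypothesis R_unit : R \in unitmx.
Hypothesis R_braid : R12 R *m R23 R *m R12 R = R23 R *m R12 R *m R23 R.
Variable Psi : 'M[K]_(N * N).
Hypothesis R_Psi : forall i j k l : 'I_N,
  \sum_a \sum_b entry R i a j b * entry Psi b l a k = ((i == k) && (l == j))%:R.
Hypothesis Psi_R : forall i j k l : 'I_N,
  \sum_a \sum_b entry Psi i a j b * entry R b l a k = ((i == k) && (l == j))%:R.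
Variables (A : algType K) (L : 'M[A]_N).
Hypothesis A_univ : presented R L.
Local Notation AA := (tensor A A).
Local Notation nzA := (oner_neq0 A).
Local Notation nzAA := (tens_neq0 A_univ nzA).
Local Notation X := (left_mx A_univ nzA).

Definition mul_op (a : A) : endo nzA := Endo nzA (linear_mull (A := A) a).

Definition mul_mx : 'M[endo nzA]_N := \matrix_(i, j) mul_op (L i j).

Lemma mul_mxE i j x : mul_mx i j x = L i j * x.
Proof. by rewrite mxE. Qed.

Lemma zero_mxE i j x : (0 : 'M[endo nzA]_N) i j x = 0.
Proof. by rewrite mxE. Qed.

Lemma mrea_defect_mul_mx : mrea_defect R mul_mx = 0.
Proof.
have fl : linear mul_op.
  by move=> c a b; apply: endoP => x; rewrite endoDE endoZE /= mulrDl scalerAl.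
have fM : monoid_morphism mul_op.
  by split=> [|a b]; apply: endoP => x; rewrite /= ?mul1r ?mulrA.
pose m1 := GRing.isLinear.Build K A (endo nzA) *:%R mul_op fl.
pose m2 := GRing.isMonoidMorphism.Build A (endo nzA) mul_op fM.
pose f : {lrmorphism A -> endo nzA} := HB.pack mul_op m1 m2.
have -> : mul_mx = map_mx f L by apply/matrixP=> i j; rewrite mxE [RHS]mxE.
rewrite -(map_mrea_defect f) (presented_defect A_univ).
by apply/matrixP=> i j; rewrite [LHS]mxE !mxE linear0.
Qed.

Variable Y : 'M[endo nzAA]_N.
Hypothesis Y_ext : is_ext mul_mx Y.

Lemma Y1 i j x : Y i j (1 ⊗ x) = 1 ⊗ (L i j * x).
Proof. by case: Y_ext => _ ->; rewrite mul_mxE. Qed.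

Lemma cross_X_Y : cross R X Y. Proof. by case: Y_ext. Qed.

Variable psi : {lrmorphism A -> endo nzAA}.
Hypothesis psiL : forall i j, psi (L i j) = Y i j.

Lemma psiM a b t : psi (a * b) t = psi a (psi b t).
Proof. by rewrite rmorphM. Qed.

Lemma psi1 t : psi 1 t = t.
Proof. by rewrite rmorph1. Qed.

Lemma linear_psi t : linear (fun b => psi b t).
Proof. by move=> c a b; rewrite linearP. Qed.

Lemma psiLE i j b t : psi (L i j * b) t = Y i j (psi b t).
Proof. by rewrite psiM psiL. Qed.

Lemma psi_1l b x : psi b (1 ⊗ x) = 1 ⊗ (b * x).
Proof.
apply: (presented_ind A_univ (P := fun b : A => psi b (1 ⊗ x) = 1 ⊗ (b * x)))
  => {b} [|c a b Pa Pb|i j b Pb].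
- by rewrite psi1 mul1r.
- by rewrite linear_psi Pa Pb mulrDl -scalerAl tens_linearr.
- by rewrite psiLE Pb Y1 mulrA.
Qed.

Definition map_mulr (y : A) : AA -> AA := tensor_map id (fun b : A => b * y).

Lemma linear_map_mulr y : linear (map_mulr y).
Proof. by apply: tensor_map_linear => //; exact: linear_mulr. Qed.

Lemma map_mulrE y a b : map_mulr y (a ⊗ b) = a ⊗ (b * y).
Proof. by apply: tensor_mapE => //; exact: linear_mulr. Qed.

(** Right multiplication by [1 ⊗ y] commutes with [X], and with [Y] on [1 ⊗ A] by associativity of
    [A]; [ext_universal] gives the rest. Hence [psi b] is determined by its values on [A ⊗ 1], that
    is, by the braiding. *)
Lemma psi_mulr b y t : map_mulr y (psi b t) =
  psi b (map_mulr y t).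
Proof.
have hX : intertwine (map_mulr y) X X.
  move=> i j; apply: tensor_mor_ext => [||a c].
  - exact: (linear_comp (linear_map_mulr y) (endo_linear _)).
  - exact: (linear_comp (endo_linear _) (linear_map_mulr y)).
  by rewrite left_mxE !map_mulrE left_mxE.
have hY := ext_universal R_unit R_Psi Psi_R (linear_map_mulr y) Y_ext hX cross_X_Y.
have {}hY : intertwine (map_mulr y) Y Y.
  by apply: hY => i j x; rewrite !map_mulrE Y1 mul_mxE mulrA.
move: t; apply: (presented_ind A_univ (P := fun b : A => forall t,
  map_mulr y (psi b t) =
  psi b (map_mulr y t))) => {b} [t|c a b Pa Pb t|i j b Pb t].
- by rewrite !psi1.
- by rewrite !linear_psi linear_map_mulr Pa Pb.
- by rewrite !psiLE hY Pb.
Qed.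

Local Notation phi := (left_op A_univ nzA).

Lemma phiM a b t : phi (a * b) t = phi a (phi b t).
Proof. by have [f fE] := left_op_morphism A_univ nzA; rewrite -!fE rmorphM. Qed.

Lemma phi1 t : phi 1 t = t.
Proof. by have [f fE] := left_op_morphism A_univ nzA; rewrite -!fE rmorph1. Qed.

Lemma linear_phi t : linear (fun a => phi a t).
Proof. by have [f fE] := left_op_morphism A_univ nzA; move=> c a b; rewrite -!fE linearP. Qed.

(** [a ⊗ b] acts as [a ⊗ 1] after [1 ⊗ b]. By [braiding_star] this is the product ⋆, whose
    associativity becomes the commutation of [act _ w] with [X] and [Y]. *)
Definition act (t w : AA) : AA := tensor_lift (fun a b => phi a (psi b w)) t.

Lemma linear_actl w : linear (fun t => act t w).
Proof.
apply: tensor_lift_linear => [b|a]; first exact: linear_phi.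
exact: (linear_comp (endo_linear _) (linear_psi w)).
Qed.

Lemma actE a b w : act (a ⊗ b) w = phi a (psi b w).
Proof.
apply: (tensor_liftE (f := fun a b => phi a (psi b w))) => [b'|a'].
  exact: linear_phi.
exact: (linear_comp (endo_linear _) (linear_psi w)).
Qed.

Lemma linear_actr t : linear (act t).
Proof.
elim/tensor_ind: t => [|d a b t IH] c u v.
  by rewrite !(linear_for0 (linear_actl _)) scaler0 addr0.
rewrite !linear_actl IH !actE !(endo_linear (psi b)) !(endo_linear (phi a)).
rewrite !scalerDr !scalerA [d * c]mulrC; exact: addrACA.
Qed.

Lemma act_phi a t w : act (phi a t) w = phi a (act t w).
Proof.
move: t; apply: tensor_mor_ext => [||c d].
- exact: (linear_comp (linear_actl w) (endo_linear _)).
- exact: (linear_comp (endo_linear _) (linear_actl w)).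
by rewrite left_opE !actE phiM.
Qed.

Lemma act_X i j t w : act (X i j t) w = X i j (act t w).
Proof. by rewrite mxE act_phi. Qed.

(** [act _ w] commutes with [X], and with [Y] on [1 ⊗ A] since [psi] is multiplicative;
    [ext_universal] extends this to all of [A ⊗ A]. *)
Lemma act_Y i j t w : act (Y i j t) w = Y i j (act t w).
Proof.
have hX : intertwine (fun t => act t w) X X by move=> k l u; rewrite act_X.
have hY := ext_universal R_unit R_Psi Psi_R (linear_actl w) Y_ext hX cross_X_Y.
by apply: hY => k l x; rewrite !actE !phi1 mul_mxE psiLE.
Qed.

Lemma act_psi b t w : act (psi b t) w = psi b (act t w).
Proof.
apply: (presented_ind A_univ (P := fun b : A => act (psi b t) w = psi b (act t w)))
  => {b} [|c a b Pa Pb|i j b Pb].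
- by rewrite !psi1.
- by rewrite !linear_psi linear_actl Pa Pb.
- by rewrite !psiLE act_Y Pb.
Qed.

Lemma act1t w : act (1 ⊗ 1) w = w.
Proof. by rewrite actE phi1 psi1. Qed.

Lemma actt1 t : act t (1 ⊗ 1) = t.
Proof.
move: t; apply: tensor_mor_ext => [||a b]; [exact: linear_actl|by []|].
by rewrite actE psi_1l left_opE !mulr1.
Qed.

Lemma act_assoc s t w : act (act s t) w = act s (act t w).
Proof.
move: s; apply: tensor_mor_ext => [||a b].
- exact: (linear_comp (linear_actl w) (linear_actl t)).
- exact: linear_actl.
by rewrite !actE act_phi act_psi.
Qed.

Lemma map_lr a y t : tensor_map (fun x : A => a * x) (fun x : A => x * y) t =
  phi a (map_mulr y t).
Proof.
move: t; apply: tensor_mor_ext => [||c d].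
- by apply: tensor_map_linear; [exact: linear_mull|exact: linear_mulr].
- exact: (linear_comp (endo_linear _) (linear_map_mulr y)).
rewrite map_mulrE left_opE; apply: tensor_mapE; [exact: linear_mull|exact: linear_mulr].
Qed.

(** The product of [1 ⊗ b] by [a ⊗ 1] in the braided square. *)
Definition braiding (t : AA) : AA := tensor_lift (fun b a => psi b (a ⊗ 1)) t.

Let braid_l a : linear (fun b : A => psi b (a ⊗ 1)).
Proof. exact: linear_psi. Qed.

Let braid_r b : linear (fun a : A => psi b (a ⊗ 1)).
Proof. exact: (linear_comp (endo_linear _) (tens_linearl (U := A) (1 : A))). Qed.

Lemma braiding_linear : linear braiding.
Proof. exact: (tensor_lift_linear braid_l braid_r). Qed.

Lemma braidingE b a : braiding (b ⊗ a) = psi b (a ⊗ 1).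
Proof. exact: (tensor_liftE braid_l braid_r). Qed.

Lemma braiding_1l a : braiding (1 ⊗ a) = a ⊗ 1.
Proof. by rewrite braidingE psi1. Qed.

Lemma braiding_1r a : braiding (a ⊗ 1) = 1 ⊗ a.
Proof. by rewrite braidingE psi_1l mulr1. Qed.

Lemma psi_tens b a y : psi b (a ⊗ y) = map_mulr y (psi b (a ⊗ 1)).
Proof. by rewrite psi_mulr map_mulrE mul1r. Qed.

Lemma lift_psi b t : tensor_lift (fun a y => psi b (a ⊗ y)) t = psi b t.
Proof.
have fl y : linear (fun a : A => psi b (a ⊗ y)).
  exact: (linear_comp (endo_linear _) (tens_linearl (U := A) y)).
have fr a : linear (fun y : A => psi b (a ⊗ y)).
  exact: (linear_comp (endo_linear _) (tens_linearr (V := A) a)).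
move: t; apply: tensor_mor_ext => [||a y].
- exact: (tensor_lift_linear fl fr).
- exact: endo_linear.
exact: (tensor_liftE fl fr).
Qed.

Lemma braiding_mull a b c : braiding ((a * b) ⊗ c) =
  tensor_lift (fun c' b' => map_mulr b' (braiding (a ⊗ c'))) (braiding (b ⊗ c)).
Proof.
rewrite [LHS]braidingE psiM -[LHS]lift_psi [braiding (b ⊗ c)]braidingE.
by apply: eq_tensor_lift => c' b'; rewrite psi_tens braidingE.
Qed.

Lemma map_mull_id b t : tensor_map (fun x : A => b * x) id t = phi b t.
Proof. by []. Qed.

Lemma braiding_mulr a b c : braiding (a ⊗ (b * c)) =
  tensor_lift (fun b' a' => tensor_map (fun x : A => b' * x) id (braiding (a' ⊗ c)))
    (braiding (a ⊗ b)).
Proof.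
(* Associativity in disguise: [1 ⊗ a] times [b ⊗ 1], then times [c ⊗ 1]. *)
transitivity (act (braiding (a ⊗ b)) (c ⊗ 1)).
  by rewrite [LHS]braidingE [braiding _]braidingE act_psi actE psi1 left_opE.
by apply: eq_tensor_lift => b' a'; rewrite map_mull_id braidingE.
Qed.

Lemma map_L_one (B C : algType K) (f : {lrmorphism B -> C}) (M : 'M[B]_N) :
  map_mx f (L_one M) = L_one (map_mx f M).
Proof. by rewrite /L_one map_mxT map_mx1. Qed.

Lemma map_L_two (B C : algType K) (f : {lrmorphism B -> C}) (M : 'M[B]_N) :
  map_mx f (L_two R M) = L_two R (map_mx f M).
Proof.
have fS m n (P : 'M[K]_(m, n)) : map_mx f (scal_mx B P) = scal_mx C P.
  by apply/matrixP=> i j; rewrite !mxE /= linearZ rmorph1.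
by rewrite /L_two !map_mxM !fS map_L_one.
Qed.

(** The cross relation between [X] and [Y], evaluated at [1 ⊗ 1]. *)
Lemma braiding_gen i j : braiding (\sum_k L_one L i k ⊗ L_two R L k j) =
  \sum_k L_two R L i k ⊗ L_one L k j.
Proof.
have [f fE] := left_op_morphism A_univ nzA.
have psiL1 : map_mx psi (L_one L) = L_one Y.
  by rewrite map_L_one; congr L_one; apply/matrixP=> a b; rewrite mxE psiL.
have phiL2 : map_mx f (L_two R L) = L_two R X.
  by rewrite map_L_two; congr L_two; apply/matrixP=> a b; rewrite !mxE fE.
rewrite (linear_for_sum braiding_linear).
transitivity (((L_one Y *m L_two R X) i j) (1 ⊗ 1)).
  rewrite mxE endo_sumE; apply: eq_bigr => k _.
  by rewrite -psiL1 -phiL2 !mxE endoME braidingE fE left_opE mulr1.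
rewrite cross_X_Y mxE endo_sumE; apply: eq_bigr => k _.
by rewrite -psiL1 -phiL2 !mxE endoME psi_1l fE left_opE !mulr1.
Qed.

Lemma braiding_star x y :
  tensor_lift (fun a1 b1 : A => tensor_lift (fun a2 b2 : A =>
    tensor_map (fun x : A => a1 * x) (fun x : A => x * b2) (braiding (b1 ⊗ a2))) y) x
  = act x y.
Proof.
apply: eq_tensor_lift => a1 b1.
have e a2 b2 : tensor_map (fun x : A => a1 * x) (fun x : A => x * b2)
    (braiding (b1 ⊗ a2)) = phi a1 (psi b1 (a2 ⊗ b2)).
  by rewrite map_lr braidingE -psi_tens.
have fl b2 : linear (fun a2 : A => phi a1 (psi b1 (a2 ⊗ b2))).
  apply: (linear_comp (endo_linear _)).
  exact: (linear_comp (endo_linear _) (tens_linearl (U := A) b2)).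
have fr a2 : linear (fun b2 : A => phi a1 (psi b1 (a2 ⊗ b2))).
  apply: (linear_comp (endo_linear _)).
  exact: (linear_comp (endo_linear _) (tens_linearr (V := A) a2)).
transitivity (tensor_lift (fun a2 b2 : A => phi a1 (psi b1 (a2 ⊗ b2))) y).
  exact: eq_tensor_lift.
move: y; apply: tensor_mor_ext => [||a b].
- exact: (tensor_lift_linear fl fr).
- exact: (linear_comp (endo_linear _) (endo_linear _)).
exact: (tensor_liftE fl fr).
Qed.

(** * Uniqueness of the braiding *)

Section BraidingUnique.
Variable s : AA -> AA.
Hypothesis s_linear : linear s.
Hypothesis s_gen : forall i j, s (\sum_k L_one L i k ⊗ L_two R L k j) =
  \sum_k L_two R L i k ⊗ L_one L k j.
Hypothesis s_1l : forall a, s (1 ⊗ a) = a ⊗ 1.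
Hypothesis s_1r : forall a, s (a ⊗ 1) = 1 ⊗ a.
Hypothesis s_mull : forall a b c, s ((a * b) ⊗ c) =
  tensor_lift (fun c' b' => map_mulr b' (s (a ⊗ c'))) (s (b ⊗ c)).
Hypothesis s_mulr : forall a b c, s (a ⊗ (b * c)) =
  tensor_lift (fun b' a' => tensor_map (fun x : A => b' * x) id (s (a' ⊗ c)))
    (s (a ⊗ b)).

(** The defining identity prescribes the braiding on sums only, through [L_two]. Multiplying by [Rb]
    on the right removes the inverse R-matrix and leaves the skewing of the values on pairs of
    generators, which then follow by skew invertibility. *)
Lemma skew_gen (D : AA -> AA) (Dl : linear D) i i' j j' :
  skewing R (fun a b => D (L i a ⊗ L b j)) i' j' =
  \sum_t Rbar R t ⟨j, j'⟩ *: D (\sum_k L_one L ⟨i, i'⟩ k ⊗ L_two R L k t).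
Proof.
transitivity (\sum_a D (L i a ⊗ (\sum_t Rbar R t ⟨j, j'⟩ *: L_two R L ⟨a, i'⟩ t))).
  apply: eq_bigr => a _; rewrite -mul_mx_scal /L_two -!mulmxA -scal_mxM.
  rewrite mulVmx ?Rbar_unit // scal_mx1 mulmx1 mul_mx_tensmx1.
  rewrite (linear_for_sum (tens_linearr (L i a))) (linear_for_sum Dl).
  apply: eq_bigr => b _; rewrite [scal_mx _ _ _ _]mxE /= -scalerAl mul1r.
  by rewrite (linear_forZ (tens_linearr (L i a))) (linear_forZ Dl).
transitivity (\sum_a \sum_t Rbar R t ⟨j, j'⟩ *: D (L i a ⊗ L_two R L ⟨a, i'⟩ t)).
  apply: eq_bigr => a _.
  rewrite (linear_for_sum (tens_linearr (L i a))) (linear_for_sum Dl).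
  apply: eq_bigr => t _.
  by rewrite (linear_forZ (tens_linearr (L i a))) (linear_forZ Dl).
rewrite exchange_big; apply: eq_bigr => t _.
rewrite -scaler_sumr -(linear_for_sum Dl); congr (_ *: D _).
rewrite sum_mxtens; apply: eq_bigr => a _; rewrite (bigD1 i') //= big1 => [|k ki].
  by rewrite tensmxE [1%:M _ _]mxE eqxx mulr1 addr0.
rewrite tensmxE [1%:M _ _]mxE eq_sym (negPf ki) mulr0; exact: linear_for0 (tens_linearl _).
Qed.

Lemma s_LL i a b j : s (L i a ⊗ L b j) = braiding (L i a ⊗ L b j).
Proof.
apply/eqP; rewrite -subr_eq0; apply/eqP.
pose D t := s t - braiding t.
have Dl : linear D.
  move=> c u v; rewrite /D s_linear braiding_linear scalerBr opprD.
  exact: addrACA.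
apply: (skew_eq0 R_Psi (p := fun a b => D (L i a ⊗ L b j))) => {a b} i' j'.
rewrite skew_gen // big1 // => t _.
by rewrite /D s_gen braiding_gen subrr scaler0.
Qed.

(** The result is again a combination of tensors of generators; so in [s_L], after passing the first
    letter of a word, the moving factor is still a generator and the induction hypothesis
    applies. *)
Lemma braiding_LL i a b j : braiding (L i a ⊗ L b j) =
  reorder R Psi (fun k c d l => L k c ⊗ L d l) i a b j.
Proof.
have /(crossE R_unit R_Psi Psi_R) XY := cross_X_Y.
have el : linear (fun f : endo nzAA => f (1 ⊗ 1)) by [].
transitivity ((Y i a * X b j) (1 ⊗ 1)).
  by rewrite braidingE endoME left_mxE mulr1 psiL.
rewrite XY (linear_reorder R Psi el); apply: eq_reorder => k c d l.
by rewrite endoME Y1 left_mxE !mulr1.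
Qed.

Lemma s_L c i j : s (L i j ⊗ c) = braiding (L i j ⊗ c).
Proof.
move: i j; apply: (presented_ind A_univ (P := fun c =>
  forall i j, s (L i j ⊗ c) = braiding (L i j ⊗ c))) => {c} [i j|e c d Pc Pd i j|k l c Pc i j].
- by rewrite s_1r braiding_1r.
- rewrite (tens_linearr (L i j)) s_linear braiding_linear Pc Pd //.
pose G (s : AA -> AA) := tensor_lift (fun b' a' : A =>
  tensor_map (fun x : A => b' * x) id (s (a' ⊗ c))).
have Gl (t : AA -> AA) : linear t -> linear (G t) /\
    forall b' a', G t (b' ⊗ a') = tensor_map (fun x : A => b' * x) id (t (a' ⊗ c)).
  move=> tl.
  have fl a' : linear (fun b' : A => tensor_map (fun x : A => b' * x) id (t (a' ⊗ c))).
    by move=> e b b'; rewrite !map_mull_id; exact: linear_phi.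
  have fr b' : linear (fun a' : A => tensor_map (fun x : A => b' * x) id (t (a' ⊗ c))).
    apply: (linear_comp (endo_linear (phi b'))).
    exact: (linear_comp tl (tens_linearl c)).
  by split; [exact: (tensor_lift_linear fl fr)|exact: (tensor_liftE fl fr)].
have [Gsl GsE] := Gl _ s_linear; have [Gbl GbE] := Gl _ braiding_linear.
transitivity (G s (s (L i j ⊗ L k l))); first exact: s_mulr.
transitivity (G braiding (braiding (L i j ⊗ L k l))); last exact/esym/braiding_mulr.
rewrite (s_LL i j k l) braiding_LL (linear_reorder R Psi Gsl) (linear_reorder R Psi Gbl).
by apply: eq_reorder => m n u v; rewrite GsE GbE Pc.
Qed.

Lemma braiding_unique : s = braiding.
Proof.
apply/funext; apply: tensor_mor_ext => // [|a c]; first exact: braiding_linear.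
move: c; apply: (presented_ind A_univ (P := fun a =>
  forall c, s (a ⊗ c) = braiding (a ⊗ c))) => {a} [c|e a b Pa Pb c|i j a Pa c].
- by rewrite s_1l braiding_1l.
- by rewrite (tens_linearl c) s_linear braiding_linear Pa Pb.
transitivity (tensor_lift (fun c' b' => map_mulr b' (s (L i j ⊗ c'))) (s (a ⊗ c))).
  exact: s_mull.
rewrite Pa [RHS]braiding_mull; by apply: eq_tensor_lift => c' b'; rewrite s_L.
Qed.

End BraidingUnique.

(** * The coproduct *)

Variable z : K.
Hypothesis Rbar_quad : Rbar R *m Rbar R = 1%:M + z%:M *m Rbar R.
Local Notation Z := (cop z X Y).

Lemma mrea_defect_Y : mrea_defect R Y = 0.
Proof. exact: (ext_defect R_unit R_braid R_Psi Y_ext mrea_defect_mul_mx). Qed.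

Lemma mrea_defect_Z : mrea_defect R Z = 0.
Proof.
apply: mrea_defect_cop => //; first exact: cross_X_Y.
- exact: mrea_defect_left_mx.
- exact: mrea_defect_Y.
Qed.

Variable zeta : {lrmorphism A -> endo nzAA}.
Hypothesis zetaL : forall i j, zeta (L i j) = Z i j.

Lemma zetaM a b t : zeta (a * b) t = zeta a (zeta b t).
Proof. by rewrite rmorphM. Qed.

Lemma zeta1 t : zeta 1 t = t.
Proof. by rewrite rmorph1. Qed.

Lemma linear_zeta t : linear (fun b => zeta b t).
Proof. by move=> c a b; rewrite linearP. Qed.

Lemma zetaLE i j b t : zeta (L i j * b) t = Z i j (zeta b t).
Proof. by rewrite zetaM zetaL. Qed.

Definition coproduct (a : A) : AA := zeta a (1 ⊗ 1).

Lemma coproduct_linear : linear coproduct.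
Proof. exact: linear_zeta. Qed.

Lemma coproduct_1 : coproduct 1 = 1 ⊗ 1.
Proof. exact: zeta1. Qed.

Lemma coproduct_L i j a : coproduct (L i j * a) = Z i j (coproduct a).
Proof. exact: zetaLE. Qed.

Lemma coproduct_gen i j : coproduct (L i j) =
  L i j ⊗ 1 + 1 ⊗ L i j - z *: \sum_k L i k ⊗ L k j.
Proof.
rewrite -[L i j in LHS]mulr1 coproduct_L coproduct_1 copE !endoE Y1 left_mxE !mulr1.
congr (_ - _ *: _); apply: eq_bigr => k _.
by rewrite endoME Y1 left_mxE !mulr1.
Qed.

Lemma act_Z i j t w : act (Z i j t) w = Z i j (act t w).
Proof.
rewrite !copE !endoE (linear_forB (linear_actl w)) (linear_forD (linear_actl w)).
rewrite (linear_forZ (linear_actl w)) (linear_for_sum (linear_actl w)) act_X act_Y.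
by congr (_ - _ *: _); apply: eq_bigr => k _; rewrite !endoME act_X act_Y.
Qed.

Lemma act_zeta a t w : act (zeta a t) w = zeta a (act t w).
Proof.
apply: (presented_ind A_univ (P := fun a : A => act (zeta a t) w = zeta a (act t w)))
  => {a} [|c a b Pa Pb|i j b Pb].
- by rewrite !zeta1.
- by rewrite !linear_zeta linear_actl Pa Pb.
- by rewrite !zetaLE act_Z Pb.
Qed.

(** [act _ w] commutes with [X] and [Y], hence with [Z] and with [zeta a]; so [Delta a ⋆ Delta b] is
    [zeta a] applied to [1 ⊗ 1 ⋆ Delta b]. *)
Lemma coproduct_mul a b : coproduct (a * b) = act (coproduct a) (coproduct b).
Proof. by rewrite act_zeta act1t -zetaM. Qed.

Lemma coproduct_unique (D : A -> AA) : linear D -> D 1 = 1 ⊗ 1 ->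
    (forall i j, D (L i j) = L i j ⊗ 1 + 1 ⊗ L i j - z *: \sum_k L i k ⊗ L k j) ->
    (forall a b, D (a * b) = act (D a) (D b)) -> D = coproduct.
Proof.
move=> Dl D1 DL DM; apply/funext => a.
apply: (presented_ind A_univ (P := fun a : A => D a = coproduct a))
  => {a} [|c a b Pa Pb|i j b Pb].
- by rewrite D1 coproduct_1.
- by rewrite Dl coproduct_linear Pa Pb.
- by rewrite DM DL Pb coproduct_mul coproduct_gen.
Qed.

(** * Coassociativity *)

Section Coassociativity.
Local Notation W := (tensor A AA).
Local Notation nzW := (tens_neq0 A_univ nzAA).
Local Notation X3 := (left_mx A_univ nzAA).
Variables Y3 U3 : 'M[endo nzW]_N.
Hypothesis Y3_ext : is_ext X Y3.
Hypothesis U3_ext : is_ext Y U3.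
Local Notation Q := (cop z X3 (cop z Y3 U3)).

Definition co_right : AA -> W := tensor_map id coproduct.

Lemma co_right_linear : linear co_right.
Proof. by apply: tensor_map_linear => //; exact: coproduct_linear. Qed.

Lemma co_rightE a b : co_right (a ⊗ b) = a ⊗ coproduct b.
Proof. by apply: tensor_mapE => //; exact: coproduct_linear. Qed.

Lemma YU3_ext : is_ext Z (cop z Y3 U3).
Proof. exact: ext_cop. Qed.

(** [X3], [Y3], [U3] are the three copies of [L] acting on the cube. On [1 ⊗ A], [id ⊗ Delta] turns
    multiplication by [L] into [Z] acting on the last two factors, and the extension of [Z] to the
    cube is [cop z Y3 U3]. *)
Lemma co_right_Z : intertwine co_right Z Q.
Proof.
apply: (intertwine_cop co_right_linear).
  move=> i j; apply: tensor_mor_ext => [||a b].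
  - exact: (linear_comp co_right_linear (endo_linear _)).
  - exact: (linear_comp (endo_linear _) co_right_linear).
  by rewrite left_mxE !co_rightE left_mxE.
apply: (ext_universal R_unit R_Psi Psi_R co_right_linear Y_ext (X' := X3)).
- move=> i j; apply: tensor_mor_ext => [||a b].
  - exact: (linear_comp co_right_linear (endo_linear _)).
  - exact: (linear_comp (endo_linear _) co_right_linear).
  by rewrite left_mxE !co_rightE left_mxE.
- by case: YU3_ext.
- by move=> i j x; rewrite mul_mxE !co_rightE coproduct_L; case: YU3_ext => _ ->.
Qed.

Definition assoc_op (w : A) (t : AA) : W := tensor_lift (fun u v => u ⊗ (v ⊗ w)) t.

Lemma assoc_l (w : A) : linear (assoc_op w).
Proof.
apply: tensor_lift_linear => [v|u]; first exact: tens_linearl.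
exact: (linear_comp (tens_linearr u) (tens_linearl w)).
Qed.

Lemma assocE1 (u v w : A) : assoc_op w (u ⊗ v) = u ⊗ (v ⊗ w).
Proof.
apply: (tensor_liftE (f := fun u v => u ⊗ (v ⊗ w))) => [v'|u']; first exact: tens_linearl.
exact: (linear_comp (tens_linearr u') (tens_linearl w)).
Qed.

Lemma assoc_r (t : AA) : linear (fun w : A => assoc_op w t).
Proof.
elim/tensor_ind: t => [|d u v t IH] c x y.
  by rewrite !(linear_for0 (assoc_l _)) scaler0 addr0.
rewrite !assoc_l IH !assocE1 (tens_linearr v) (tens_linearr u) !scalerDr !scalerA.
rewrite [d * c]mulrC; exact: addrACA.
Qed.

Lemma assoc_linear : linear (@tensor_assoc K A A A).
Proof. exact: (tensor_lift_linear assoc_l assoc_r). Qed.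

Lemma assocE (t : AA) (w : A) :
  tensor_assoc (t ⊗ w) = assoc_op w t.
Proof. exact: (tensor_liftE assoc_l assoc_r). Qed.

Definition co_left (t : AA) : W := tensor_assoc (tensor_map coproduct id t).

Lemma co_left_linear : linear co_left.
Proof.
apply: (linear_comp assoc_linear); apply: tensor_map_linear => //.
exact: coproduct_linear.
Qed.

Lemma co_leftE a b : co_left (a ⊗ b) =
  assoc_op b (coproduct a).
Proof.
rewrite /co_left tensor_mapE //; first exact: assocE.
exact: coproduct_linear.
Qed.

Lemma assoc_Z (w : A) :
  intertwine (assoc_op w) Z (cop z X3 Y3).
Proof.
have hX : intertwine (assoc_op w) X X3.
  move=> i j; apply: tensor_mor_ext => [||a b].
  - exact: (linear_comp (assoc_l w) (endo_linear _)).
  - exact: (linear_comp (endo_linear _) (assoc_l w)).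
  by rewrite left_mxE !assocE1 left_mxE.
apply: (intertwine_cop (assoc_l w) z hX).
apply: (ext_universal R_unit R_Psi Psi_R (assoc_l w) Y_ext hX); first by case: Y3_ext.
move=> i j x; rewrite !assocE1 mul_mxE; case: Y3_ext => _ ->.
by rewrite left_mxE.
Qed.

(** For [z] nonzero this is associativity of the product of the matrices [1 - z M]; the direct
    expansion covers [z = 0] too. *)
Lemma cop_assoc (B : algType K) (M M' M'' : 'M[B]_N) :
  cop z (cop z M M') M'' = cop z M (cop z M' M'').
Proof.
rewrite /cop !(mulmxBl, mulmxBr, mulmxDl, mulmxDr) !mulmxA.
rewrite -[sc B N z *m M *m sc B N z]mulmxA -[M *m sc B N z]scC !mulmxA.
rewrite !opprB !opprD !addrA.
by rewrite [LHS](ACl (1*2*4*7*5*3*6)).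
Qed.

(** [Delta ⊗ id] turns [X] into [cop z X3 Y3] and [Y] into [U3]. The cross relation required by
    [ext_universal] combines that of [X3] with [U3], part of the extension, and that of [Y3] with
    [U3], transported from [X] and [Y] by [ext_cross]. *)
Lemma co_left_Z : intertwine co_left Z Q.
Proof.
rewrite -cop_assoc.
have hX : intertwine co_left X (cop z X3 Y3).
  move=> i j; apply: tensor_mor_ext => [||a b].
  - exact: (linear_comp co_left_linear (endo_linear _)).
  - exact: (linear_comp (endo_linear _) co_left_linear).
  by rewrite left_mxE !co_leftE coproduct_L assoc_Z.
apply: (intertwine_cop co_left_linear z hX).
apply: (ext_universal R_unit R_Psi Psi_R co_left_linear Y_ext hX).
  apply: (cross_copl R_unit); first by case: U3_ext.
  exact: (ext_cross R_unit R_braid R_Psi Y3_ext U3_ext cross_X_Y).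
move=> i j x; rewrite mul_mxE !co_leftE coproduct_1 !assocE1.
by case: U3_ext => _ ->; rewrite Y1.
Qed.

Lemma coproduct_coassoc a : co_left (coproduct a) = co_right (coproduct a).
Proof.
apply: (presented_ind A_univ (P := fun a : A =>
  co_left (coproduct a) = co_right (coproduct a))) => {a} [|c a b Pa Pb|i j b Pb].
- by rewrite coproduct_1 co_leftE co_rightE coproduct_1 assocE1.
- by rewrite coproduct_linear co_left_linear co_right_linear Pa Pb.
- by rewrite coproduct_L co_left_Z co_right_Z Pb.
Qed.

End Coassociativity.

(** * Counit laws *)

Section Counit.
Variable eps : {lrmorphism A -> K^o}.
Hypothesis epsL : forall i j, eps (L i j) = 0.

Let eps_r_lin1 (y : A) : linear (fun x : A => (eps y : K) *: x).
Proof. by move=> c u v; rewrite scalerDr !scalerA mulrC. Qed.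

Let eps_r_lin2 (x : A) : linear (fun y : A => (eps y : K) *: x).
Proof. by move=> c u v; rewrite linearP /= scalerDl scalerA. Qed.

Lemma eps_ML i j x : (eps (L i j * x) : K) = 0.
Proof. by rewrite rmorphM /= epsL mul0r. Qed.

(** [id ⊗ eps] intertwines [X] with multiplication by [L] and [Y] with 0, hence [Z] with
    multiplication by [L]; the other law exchanges the two roles. *)
Lemma coproduct_counit_r a :
  tensor_lift (fun x y : A => (eps y : K) *: x) (coproduct a) = a.
Proof.
pose u t := tensor_lift (fun x y : A => (eps y : K) *: x) t.
have ul : linear u by exact: (tensor_lift_linear eps_r_lin1 eps_r_lin2).
have uE x y : u (x ⊗ y) = (eps y : K) *: x by exact: (tensor_liftE eps_r_lin1 eps_r_lin2).
have hX : intertwine u X mul_mx.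
  move=> i j; apply: tensor_mor_ext => [||x y].
  - exact: (linear_comp ul (endo_linear _)).
  - exact: (linear_comp (endo_linear _) ul).
  by rewrite left_mxE !uE mul_mxE scalerAr.
have hY : intertwine u Y (0 : 'M[endo nzA]_N).
  apply: (ext_universal R_unit R_Psi Psi_R ul Y_ext hX).
    exact: cross0r.
  by move=> i j x; rewrite !uE mul_mxE eps_ML scale0r mxE.
have hZ := intertwine_cop ul z hX hY.
apply: (presented_ind A_univ (P := fun a : A => u (coproduct a) = a))
  => {a} [|c a b Pa Pb|i j b Pb].
- by rewrite coproduct_1 uE rmorph1 scale1r.
- by rewrite coproduct_linear ul Pa Pb.
rewrite coproduct_L hZ Pb copE [X in _ *: X]big1 => [|k _].
  by rewrite !endoE mul_mxE zero_mxE scaler0 subr0 addr0.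
by rewrite [X in _ * X]mxE mulr0.
Qed.

Lemma coproduct_counit_l a :
  tensor_lift (fun x y : A => (eps x : K) *: y) (coproduct a) = a.
Proof.
pose u t := tensor_lift (fun x y : A => (eps x : K) *: y) t.
have ul : linear u by exact: (tensor_lift_linear eps_r_lin2 eps_r_lin1).
have uE x y : u (x ⊗ y) = (eps x : K) *: y by exact: (tensor_liftE eps_r_lin2 eps_r_lin1).
have hX : intertwine u X (0 : 'M[endo nzA]_N).
  move=> i j; apply: tensor_mor_ext => [||x y].
  - exact: (linear_comp ul (endo_linear _)).
  - exact: (linear_comp (endo_linear _) ul).
  by rewrite left_mxE !uE eps_ML scale0r mxE.
have hY : intertwine u Y mul_mx.
  apply: (ext_universal R_unit R_Psi Psi_R ul Y_ext hX).
    exact: cross0l.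
  by move=> i j x; rewrite !uE mul_mxE rmorph1 !scale1r mul_mxE.
have hZ := intertwine_cop ul z hX hY.
apply: (presented_ind A_univ (P := fun a : A => u (coproduct a) = a))
  => {a} [|c a b Pa Pb|i j b Pb].
- by rewrite coproduct_1 uE rmorph1 scale1r.
- by rewrite coproduct_linear ul Pa Pb.
rewrite coproduct_L hZ Pb copE [X in _ *: X]big1 => [|k _].
  by rewrite !endoE mul_mxE zero_mxE scaler0 subr0 add0r.
by rewrite [X in X * _]mxE mul0r.
Qed.

End Counit.

End BraidedSquare.

(** * The theorem for any algebra with the presentation *)

Section Presentation.
Variables (K : fieldType) (N : nat) (q : K) (R : 'M[K]_(N * N)).
Variables (A : algType K) (L : 'M[A]_N).
Local Notation AA := (tensor A A).

(** This record and the next ones restate the notions of the theorem for an abstract presented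
    algebra, so that the construction never looks into the quotient defining [mrea]. *)
Record braiding_axioms (s : AA -> AA) : Prop := BraidingAxioms {
  braiding_axioms_linear : linear s;
  braiding_axioms_gen : forall i j, s (\sum_k L_one L i k ⊗ L_two R L k j) =
    \sum_k L_two R L i k ⊗ L_one L k j;
  braiding_axioms_1l : forall a : A, s (1 ⊗ a) = a ⊗ 1;
  braiding_axioms_1r : forall a : A, s (a ⊗ 1) = 1 ⊗ a;
  braiding_axioms_mull : forall a b c : A, s ((a * b) ⊗ c) =
    tensor_lift (fun c' b' : A => tensor_map id (fun x : A => x * b') (s (a ⊗ c')))
      (s (b ⊗ c));
  braiding_axioms_mulr : forall a b c : A, s (a ⊗ (b * c)) =
    tensor_lift (fun b' a' : A => tensor_map (fun x : A => b' * x) id (s (a' ⊗ c)))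
      (s (a ⊗ b))
}.

Definition braided_mul (s : AA -> AA) (x y : AA) : AA :=
  tensor_lift (fun a1 b1 : A => tensor_lift (fun a2 b2 : A =>
    tensor_map (fun x : A => a1 * x) (fun x : A => x * b2) (s (b1 ⊗ a2))) y) x.

Record coproduct_axioms (s : AA -> AA) (D : A -> AA) : Prop := CoproductAxioms {
  coproduct_axioms_linear : linear D;
  coproduct_axioms_1 : D 1 = 1 ⊗ 1;
  coproduct_axioms_gen : forall i j, D (L i j) =
    L i j ⊗ 1 + 1 ⊗ L i j - (q - q^-1) *: \sum_k L i k ⊗ L k j;
  coproduct_axioms_mul : forall a b, D (a * b) = braided_mul s (D a) (D b)
}.

Record counit_axioms (eps : A -> K) : Prop := CounitAxioms {
  counit_axioms_linear : scalar eps;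
  counit_axioms_1 : eps 1 = 1;
  counit_axioms_gen : forall i j, eps (L i j) = 0;
  counit_axioms_mul : forall a b, eps (a * b) = eps a * eps b
}.

Hypothesis A_univ : presented R L.

Lemma counit_axioms_exists : exists eps, counit_axioms eps /\
  forall eps', counit_axioms eps' -> eps' = eps.
Proof.
have [f fL] := counit_exists A_univ.
exists (f : A -> K); split=> [|eps' [el e1 eL eM]].
  split=> //; [exact: linearP|exact: rmorph1|exact: rmorphM].
apply/funext; apply: (presented_ind A_univ (P := fun x => eps' x = f x)).
- by rewrite e1 rmorph1.
- by move=> c x y Px Py; rewrite el linearP Px Py.
- by move=> i j x _; rewrite eM eL mul0r rmorphM /= fL mul0r.
Qed.

Lemma braided_bialgebra_exists : hecke_symmetry q R -> skew_invertible R ->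
  exists (s : AA -> AA) (D : A -> AA), [/\
    braiding_axioms s, forall s', braiding_axioms s' -> s' = s,
    coproduct_axioms s D, forall D', coproduct_axioms s D' -> D' = D &
    [/\ forall y, linear (braided_mul s ^~ y), forall x, linear (braided_mul s x),
        associative (braided_mul s), left_id (1 ⊗ 1) (braided_mul s) &
        right_id (1 ⊗ 1) (braided_mul s)] /\
    (forall a, tensor_assoc (tensor_map D id (D a)) = tensor_map id D (D a)) /\
    (forall eps, counit_axioms eps -> forall a,
      tensor_lift (fun x y : A => eps y *: x) (D a) = a /\
      tensor_lift (fun x y : A => eps x *: y) (D a) = a)].
Proof.
move=> [R_unit R_braid R_quad q0 _] [Psi PsiE].
have R_Psi i j k l := (PsiE i j k l).1; have Psi_R i j k l := (PsiE i j k l).2.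
have [Y Y_ext] := ext_exists R_unit R_braid R_Psi Psi_R A_univ (mul_mx L).
have [psi psiL] := presented_lift A_univ (mrea_defect_Y R_unit R_braid R_Psi Y_ext).
have quad := Rbar_sqr q0 R_quad.
have [zeta zetaL] := presented_lift A_univ
  (mrea_defect_Z R_unit R_braid R_Psi Y_ext quad).
pose s := braiding psi; pose D := coproduct zeta.
have starE : braided_mul s = act psi.
  by apply/funext => x; apply/funext => y; exact: (braiding_star R_unit R_Psi Psi_R Y_ext psiL).
exists s, D; split.
- split.
  + exact: braiding_linear.
  + exact: (braiding_gen Y_ext psiL).
  + exact: braiding_1l.
  + exact: (braiding_1r Y_ext psiL).
  + exact: (braiding_mull R_unit R_Psi Psi_R Y_ext psiL).
  + exact: (braiding_mulr R_unit R_Psi Psi_R Y_ext psiL).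
- move=> s' [sl sg s1 s2 s3 s4].
  exact: (braiding_unique R_unit R_Psi Psi_R Y_ext psiL sl sg s1 s2 s3 s4).
- split.
  + exact: coproduct_linear.
  + exact: coproduct_1.
  + exact: (coproduct_gen Y_ext zetaL).
  + by move=> a b; rewrite starE; exact: (coproduct_mul R_unit R_Psi Psi_R Y_ext psiL zetaL).
- move=> D' [Dl D1 Dg DM]; rewrite starE in DM.
  exact: (coproduct_unique R_unit R_Psi Psi_R Y_ext psiL zetaL Dl D1 Dg DM).
(* The second and third copies of [L] on the cube extend the two copies [X] and [Y] on the
   square. *)
have [Y3 Y3_ext] := ext_exists R_unit R_braid R_Psi Psi_R A_univ
  (left_mx A_univ (oner_neq0 A)).
have [U3 U3_ext] := ext_exists R_unit R_braid R_Psi Psi_R A_univ Y.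
split; [rewrite starE; split|split].
- exact: linear_actl.
- exact: linear_actr.
- move=> x y w; apply/esym; exact: (act_assoc R_unit R_Psi Psi_R Y_ext psiL).
- exact: act1t.
- exact: (actt1 Y_ext psiL).
- exact: (coproduct_coassoc R_unit R_braid R_Psi Psi_R Y_ext zetaL Y3_ext U3_ext).
move=> eps [el e1 eL eM] a.
have em : monoid_morphism (eps : A -> K^o) by split; [exact: e1|exact: eM].
pose m1 := GRing.isLinear.Build K A K^o *:%R (eps : A -> K^o) el.
pose m2 := GRing.isMonoidMorphism.Build A K^o (eps : A -> K^o) em.
pose f : {lrmorphism A -> K^o} := HB.pack (eps : A -> K^o) m1 m2.
split.
- exact: (coproduct_counit_r R_unit R_Psi Psi_R Y_ext zetaL (eps := f)).
- exact: (coproduct_counit_l R_unit R_Psi Psi_R Y_ext zetaL (eps := f)).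
Qed.

End Presentation.

Lemma is_R_EndE (K : fieldType) (N : nat) (R : 'M[K]_(N * N))
    (s : tensor (mrea R) (mrea R) -> tensor (mrea R) (mrea R)) :
  is_R_End s <-> braiding_axioms R (mrea_L R) s.
Proof.
split=> [[sl sg s1 s2 s3 s4]|[sl sg s1 s2 s3 s4]]; split.
- exact: sl.
- move=> i j; have /matrixP/(_ i j) := sg.
  by rewrite [LHS]mxE [X in s X]mxE [RHS]mxE.
- exact: s1.
- exact: s2.
- exact: s3.
- exact: s4.
- exact: sl.
- apply/matrixP => i j; rewrite [LHS]mxE [X in s X]mxE [RHS]mxE.
  exact: sg.
- exact: s1.
- exact: s2.
- exact: s3.
- exact: s4.
Qed.

Lemma starE (K : fieldType) (N : nat) (R : 'M[K]_(N * N))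
    (s : tensor (mrea R) (mrea R) -> tensor (mrea R) (mrea R)) :
  star s = braided_mul s.
Proof. by rewrite /star /braided_mul. Qed.

Theorem proposition27 (K : fieldType) (N : nat) (q : K)
    (R : 'M[K]_(N * N)) (HR : hecke_symmetry q R) (HS : skew_invertible R) :
  (exists! R_End : tensor (mrea R) (mrea R) -> tensor (mrea R) (mrea R),
     is_R_End R_End) /\
  forall R_End : tensor (mrea R) (mrea R) -> tensor (mrea R) (mrea R),
    is_R_End R_End ->
    [/\ exists! Delta : mrea R -> tensor (mrea R) (mrea R),
          is_Delta R_End q Delta,
        exists! eps : mrea R -> K, is_eps eps
      & forall (Delta : mrea R -> tensor (mrea R) (mrea R))
               (eps : mrea R -> K),
          is_Delta R_End q Delta -> is_eps eps ->
          braided_bialgebra R_End Delta eps].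
Proof.
have [s [D [s_ax s_uniq D_ax D_uniq [star_ax [coass counit]]]]] :=
  braided_bialgebra_exists (mrea_presented R) HR HS.
have [eps [eps_ax eps_uniq]] := counit_axioms_exists (mrea_presented R).
have DE D' : is_Delta s q D' -> D' = D.
  by case=> d1 d2 d3 d4; apply: D_uniq; rewrite starE in d4; exact: (CoproductAxioms d1 d2 d3 d4).
have epsE eps' : is_eps eps' -> counit_axioms (mrea_L R) eps'.
  by case=> e1 e2 e3 e4; split.
split.
  exists s; split=> [|s' /is_R_EndE]; first exact/is_R_EndE.
  by move=> /s_uniq.
(* By uniqueness an arbitrary braiding is the constructed one; the given coproduct is replaced in
   the same way below. *)
move=> s' /is_R_EndE /s_uniq -> {s'}; split.
- exists D; split=> [|D' /DE]; last by [].
  by case: D_ax => d1 d2 d3 d4; split; rewrite ?starE.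
- exists eps; split=> [|eps' /epsE /eps_uniq]; last by [].
  by case: eps_ax => e1 e2 e3 e4; split.
move=> D' eps' /[dup] /DE DD' _ /epsE eps'_ax; rewrite {}DD' {D'}.
case: star_ax => st1 st2 st3 st4 st5; case: D_ax => d1 d2 d3 d4.
have cu := counit _ eps'_ax; case: eps'_ax => e1 e2 e3 e4.
split; rewrite ?starE.
- exact: st1.
- exact: st2.
- exact: st3.
- exact: st4.
- exact: st5.
- exact: d1.
- exact: d2.
- exact: d4.
- exact: coass.
- exact: e1.
- exact: e2.
- exact: e4.
- exact: (fun a => (cu a).1).
- exact: (fun a => (cu a).2).
Qed.
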